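(* Let $n\in\mathbb{N}$ and let $k\in\mathbb{N}$ with $1\le k\le n$. Let $1\le i_1<\cdots<i_k\le n$ and $1\le j_1<\cdots<j_k\le n$ be indices, and let $M=M_{i_1,\ldots,i_k;j_1,\ldots,j_k}:\mathbb{R}^{n\times n}\to\mathbb{R}^{k\times k}$ and $\bar M=\bar M_{i_1,\ldots,i_k;j_1,\ldots,j_k}:\mathbb{R}^{k\times k}\to\mathbb{R}^{n\times n}$ be the associated submatrix-extraction map and zero-extension map. Let $u\in C_c^\infty(\mathbb{R}^n,\mathbb{R}^n)$ and $s\in(0,1)$. Then $$\operatorname{Div}^s\bigl(\bar M(\operatorname{cof} M(D^su))\bigr)=0 .$$
   Context: Principal value: $\operatorname{pv}_x\int f=\lim_{r\to0}\int_{B(x,r)^c}f$, where $B(x,r)^c$ is the complement in $\mathbb{R}^n$ of the open ball $B(x,r)$; integrals without domain are over $\mathbb{R}^n$. Constant: $c_{n,s}=-(n+s-1)\dfrac{\Gamma\left(\frac{n+s-1}{2}\right)}{\pi^{n/2}\,2^{1-s}\,\Gamma\left(\frac{1-s}{2}\right)}$. Fractional gradient of $u:\mathbb{R}^n\to\mathbb{R}^n$: the matrix $D^su(x)=c_{n,s}\operatorname{pv}_x\int\frac{u(x)-u(y)}{|x-y|^{n+s}}\otimes\frac{x-y}{|x-y|}\,dy$ (row index: component of $u$; column index: component of $x-y$). Fractional divergence of $\phi:\mathbb{R}^n\to\mathbb{R}^n$: $\operatorname{div}^s\phi(x)=-c_{n,s}\operatorname{pv}_x\int\frac{\phi(x)+\phi(y)}{|x-y|^{n+s}}\cdot\frac{x-y}{|x-y|}\,dy$.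 For a matrix field $A:\mathbb{R}^n\to\mathbb{R}^{n\times n}$, $\operatorname{Div}^sA$ is the column vector field whose components are the $s$-fractional divergences of the rows of $A$. $M(F)$ is the $k\times k$ submatrix of $F\in\mathbb{R}^{n\times n}$ formed by rows $i_1,\ldots,i_k$ and columns $j_1,\ldots,j_k$. For $F\in\mathbb{R}^{k\times k}$, $\bar M(F)\in\mathbb{R}^{n\times n}$ is the matrix whose $(i_a,j_b)$ entry equals $F_{ab}$ for $1\le a,b\le k$, all other entries being zero. $\operatorname{cof}A$ is the cofactor matrix, satisfying $(\operatorname{cof}A)A^T=(\det A)I$ (for $k=1$, $\operatorname{cof}A=1$). *)

(* Defs.v *)
From HB Require Import structures.
From mathcomp Require Import all_boot all_order all_algebra.
From mathcomp Require Import all_classical all_reals all_analysis.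

Set Implicit Arguments.
Unset Strict Implicit.
Unset Printing Implicit Defensive.

Import Order.TTheory GRing.Theory Num.Theory.
Import numFieldNormedType.Exports.

Local Open Scope classical_set_scope.
Local Open Scope ring_scope.

(* [R^n] is ['rV[R]_n] throughout. The sigma-algebra is the one generated by
   the coordinates, which is the Borel sigma-algebra of [R^n]. *)

Definition measure_rV_display : measure_display -> measure_display.
Proof. exact. Qed.

Section measurable_rV.
Context {d} {T : sigmaRingType d} (n : nat).

Let coord : 'I_n -> 'rV[T]_n -> T := fun i x => x ord0 i.

Let rV_set0 : g_sigma_preimage coord set0.
Proof. exact: sigma_algebra0. Qed.

Let rV_setC A : g_sigma_preimage coord A -> g_sigma_preimage coord (~` A).
Proof. exact: sigma_algebraC. Qed.

Let rV_bigcup (F : _^nat) : (forall i, g_sigma_preimage coord (F i)) ->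
  g_sigma_preimage coord (\bigcup_i (F i)).
Proof. exact: sigma_algebra_bigcup. Qed.

HB.instance Definition _ := @isMeasurable.Build (measure_rV_display d)
  'rV[T]_n (g_sigma_preimage coord) rV_set0 rV_setC rV_bigcup.

End measurable_rV.

Lemma measurable_coord d (T : sigmaRingType d) n (i : 'I_n) :
  measurable_fun [set: 'rV[T]_n] (fun x : 'rV[T]_n => x ord0 i).
Proof.
move=> _ Y mY; rewrite setTI; apply: sub_sigma_algebra => /=.
rewrite -bigcup_seq/=; exists i => /=; first by rewrite mem_index_enum.
by exists Y => //; rewrite setTI.
Qed.

Lemma measurable_fun_coordP d1 d2 (T1 : measurableType d1)
    (T2 : measurableType d2) n (f : T1 -> 'rV[T2]_n) :
  measurable_fun [set: T1] f <->
  forall i, measurable_fun [set: T1] (fun t => f t ord0 i).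
Proof.
split=> [mf i|mf].
  by apply: (measurableT_comp (f := fun x : 'rV[T2]_n => x ord0 i)) => //;
    exact: measurable_coord.
pose F : set (set 'rV[T2]_n) := image_set_system setT f measurable.
suff sF : measurable `<=` F.
  move=> _ A mA; rewrite setTI.
  by move: (sF _ mA); rewrite /F /image_set_system /= setTI.
apply: smallest_sub.
  by apply: sigma_algebra_image; exact: sigma_algebra_measurable.
case: n f mf @F => [|n] f mf F; first by rewrite big_ord0.
rewrite -bigcup_mkord_ord; apply: bigcup_sub => i Ii.
move=> A [B mB <-] /=; rewrite /F /image_set_system /= !setTI.
by have := mf (inord i) measurableT B mB; rewrite setTI.
Qed.

(* Lebesgue measure on [R^n], as the n-fold product of the one-dimensional
   Lebesgue measure. *)

Section lebesgue_step.
Context {R : realType} (n : nat).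

Definition rV_cons (p : R * 'rV[R]_n) : 'rV[R]_n.+1 :=
  row_mx (p.1)%:M p.2 : 'rV[R]_(1 + n).

Lemma rV_cons0 p : rV_cons p ord0 ord0 = p.1.
Proof.
transitivity ((p.1)%:M ord0 (ord0 : 'I_1)); last by rewrite mxE eqxx mulr1n.
rewrite -[RHS](row_mxEl _ p.2).
by congr (rV_cons p _ _); exact: val_inj.
Qed.

Lemma rV_consS p i : rV_cons p ord0 (lift ord0 i) = p.2 ord0 i.
Proof.
rewrite -[RHS](row_mxEr (p.1)%:M p.2 ord0 i).
by congr (rV_cons p _ _); exact: val_inj.
Qed.

Lemma measurable_rV_cons : measurable_fun [set: R * 'rV[R]_n] rV_cons.
Proof.
apply/measurable_fun_coordP => i.
case: (unliftP ord0 i) => [j|] ->.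
  under eq_fun do rewrite rV_consS.
  by apply: (measurableT_comp (f := fun x : 'rV[R]_n => x ord0 j)) => //;
    exact: measurable_coord.
under eq_fun do rewrite rV_cons0.
exact: measurable_fst.
Qed.

Variable mu : {sigma_finite_measure set 'rV[R]_n -> \bar R}.

Definition lebesgue_rVS : set 'rV[R]_n.+1 -> \bar R :=
  pushforward (lebesgue_measure \x mu)%E rV_cons.

Let lebesgue_rVS0 : lebesgue_rVS set0 = 0%E.
Proof. have mf := measurable_rV_cons; exact: measure0. Qed.

Let lebesgue_rVS_ge0 A : (0 <= lebesgue_rVS A)%E.
Proof. have mf := measurable_rV_cons; exact: measure_ge0. Qed.

Let lebesgue_rVS_sigma_additive : semi_sigma_additive lebesgue_rVS.
Proof.
have mf := measurable_rV_cons; exact: measure_semi_sigma_additive.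
Qed.

HB.instance Definition _ := isMeasure.Build _ _ _ lebesgue_rVS
  lebesgue_rVS0 lebesgue_rVS_ge0 lebesgue_rVS_sigma_additive.

Let sigma_finite_lebesgue_rVS : sigma_finite [set: 'rV[R]_n.+1] lebesgue_rVS.
Proof.
have /sigma_finiteP[F [TF ndF Foo]] :=
  sigma_finiteT (@lebesgue_measure R : {sigma_finite_measure set _ -> \bar R}).
have /sigma_finiteP[G [TG ndG Goo]] := sigma_finiteT mu.
pose g (x : 'rV[R]_n.+1) := (x ord0 ord0, \row_i x ord0 (lift ord0 i)).
have mg : measurable_fun [set: 'rV[R]_n.+1] g.
  apply/measurable_fun_pair; first exact: measurable_coord.
  apply/measurable_fun_coordP => i.
  by under eq_fun do rewrite mxE; exact: measurable_coord.
have consgK (p : R * 'rV[R]_n) : g (rV_cons p) = p.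
  case: p => a v; rewrite /g rV_cons0; congr pair.
  by apply/rowP => i; rewrite mxE rV_consS.
exists (fun i => g @^-1` (F i `*` G i)).
  apply/esym; rewrite -subTset => x _.
  have [i _ Fi] : (\bigcup_i F i) (g x).1 by rewrite -TF.
  have [j _ Gj] : (\bigcup_i G i) (g x).2 by rewrite -TG.
  exists (maxn i j) => //; split.
    by move: (g x).1 Fi; exact/subsetPset/ndF/leq_maxl.
  by move: (g x).2 Gj; exact/subsetPset/ndG/leq_maxr.
move=> i; have [mF Fy] := Foo i; have [mG Gy] := Goo i; split.
  by rewrite -[X in measurable X]setTI; apply: mg => //; exact: measurableX.
rewrite /lebesgue_rVS /pushforward -comp_preimage.
rewrite (_ : g \o rV_cons = id); last exact/funext.
by rewrite preimage_id product_measure1E// lte_mul_pinfty// ge0_fin_numE.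
Qed.

HB.instance Definition _ := Measure_isSigmaFinite.Build _ _ _ lebesgue_rVS
  sigma_finite_lebesgue_rVS.

End lebesgue_step.

Fixpoint lebesgue_rV {R : realType} (n : nat) :
    {sigma_finite_measure set 'rV[R]_n -> \bar R} :=
  match n with
  | 0 => dirac (0 : 'rV[R]_0)
  | m.+1 => lebesgue_rVS (lebesgue_rV m)
  end.

Lemma measurable_box d (T : measurableType d) n (A : 'I_n -> set T) :
  (forall i, measurable (A i)) ->
  measurable [set x : 'rV[T]_n | forall i, A i (x ord0 i)].
Proof.
move=> mA; have -> : [set x : 'rV[T]_n | forall i, A i (x ord0 i)] =
    \bigcap_(i in [set: 'I_n]) [set x : 'rV[T]_n | A i (x ord0 i)].
  by apply/seteqP; split => x /= Ax i; [move=> _; exact: Ax|exact: Ax].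
apply: fin_bigcap_measurable; first exact: finite_finset.
move=> i _.
by have := @measurable_coord _ T n i measurableT _ (mA i); rewrite setTI.
Qed.

Lemma lebesgue_rV_box (R : realType) n (A : 'I_n -> set R) :
  (forall i, measurable (A i)) ->
  lebesgue_rV n [set x | forall i, A i (x ord0 i)] =
  (\prod_(i < n) lebesgue_measure (A i))%E.
Proof.
elim: n A => [|n IHn] A mA.
  by rewrite big_ord0 /= diracE mem_set//= => -[].
pose B : set 'rV[R]_n := [set x | forall i, A (lift ord0 i) (x ord0 i)].
have mB : measurable B.
  exact: (@measurable_box _ _ n (fun i => A (lift ord0 i))).
rewrite big_ord_recl -(IHn (fun i => A (lift ord0 i)))//.
transitivity ((lebesgue_measure \x lebesgue_rV n)%E (A ord0 `*` B)).
  rewrite /= /lebesgue_rVS /pushforward; congr (_ _).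
  apply/seteqP; split => -[a v] /=.
    move=> Aav; split; first by have := Aav ord0; rewrite rV_cons0.
    by move=> i; have := Aav (lift ord0 i); rewrite rV_consS.
  move=> [Aa Av] i; case: (unliftP ord0 i) => [j|] ->.
    by rewrite rV_consS; exact: Av.
  by rewrite rV_cons0.
exact: (@product_measure1E _ _ (measurableTypeR R) 'rV[R]_n R
  lebesgue_measure (lebesgue_rV n) (A ord0) B (mA ord0) mB).
Qed.

(* Euclidean structure: the norm that the library puts on ['rV[R]_n] is the
   sup norm, and [ball] is the corresponding ball. Both induce the same
   topology, so that derivatives, continuity and compactness are unaffected. *)

Definition enorm {R : realType} n (x : 'rV[R]_n) : R :=
  Num.sqrt (\sum_i x ord0 i ^+ 2).

Definition eball {R : realType} n (x : 'rV[R]_n) (r : R) : set 'rV[R]_n :=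
  [set y | enorm (y - x) < r].

Section smooth.
Context {R : realType} {n : nat} {V : normedModType R}.
Implicit Types f : 'rV[R]_n -> V.

Definition partial (i : 'I_n) f : 'rV[R]_n -> V :=
  fun x => 'D_(delta_mx ord0 i) f x.

Definition iter_partial (l : seq 'I_n) f : 'rV[R]_n -> V := foldr partial f l.

Definition smooth f := forall l : seq 'I_n,
  continuous (iter_partial l f) /\
  forall (i : 'I_n) x, derivable (iter_partial l f) x (delta_mx ord0 i).

Definition compactly_supported f := compact (closure [set x | f x != 0]).

End smooth.

Section principal_value.
Context {R : realType} {n : nat}.
Implicit Types (x : 'rV[R]_n) (f : 'rV[R]_n -> R).

Definition truncated_integral x f (r : R) : R :=
  \int[lebesgue_rV n]_(y in ~` eball x r) f y.

Definition pv x f : R := lim (truncated_integral x f r @[r --> 0^'+]).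

(* [pv x f] takes an unspecified value when the principal value does not
   exist; [has_pv x f] says that it exists. *)
Definition has_pv x f : Prop :=
  (forall r, 0 < r ->
     (lebesgue_rV n).-integrable (~` eball x r) (fun y => (f y)%:E)) /\
  cvg (truncated_integral x f r @[r --> 0^'+]).

End principal_value.

(* Euler's integral; convergent, hence meaningful, for [a > 0] only. *)
Definition Gamma {R : realType} (a : R) : R :=
  \int[lebesgue_measure]_(t in `]0, +oo[) (t `^ (a - 1) * expR (- t)).

Definition frac_const {R : realType} (n : nat) (s : R) : R :=
  - (n%:R + s - 1) *
  (Gamma ((n%:R + s - 1) / 2) /
   (pi `^ (n%:R / 2) * 2 `^ (1 - s) * Gamma ((1 - s) / 2))).

Section fractional_operators.
Context {R : realType} {n : nat} (s : R).
Implicit Types (x y : 'rV[R]_n) (phi : 'rV[R]_n -> 'rV[R]_n).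

Definition fgrad_kernel (u : 'rV[R]_n -> 'rV[R]_n) x (i j : 'I_n) y : R :=
  (u x - u y) ord0 i / enorm (x - y) `^ (n%:R + s) *
  ((x - y) ord0 j / enorm (x - y)).

Definition fgrad (u : 'rV[R]_n -> 'rV[R]_n) x : 'M[R]_n :=
  \matrix_(i, j) (frac_const n s * pv x (fgrad_kernel u x i j)).

Definition has_fgrad u x := forall i j, has_pv x (fgrad_kernel u x i j).

Definition fdiv_kernel phi x y : R :=
  \sum_j (phi x + phi y) ord0 j / enorm (x - y) `^ (n%:R + s) *
         ((x - y) ord0 j / enorm (x - y)).

Definition fdiv phi x : R := - frac_const n s * pv x (fdiv_kernel phi x).

Definition has_fdiv phi x := has_pv x (fdiv_kernel phi x).

Definition fDiv (A : 'rV[R]_n -> 'M[R]_n) x : 'cV[R]_n :=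
  \col_i fdiv (fun y => row i (A y)) x.

Definition has_fDiv (A : 'rV[R]_n -> 'M[R]_n) x :=
  forall i, has_fdiv (fun y => row i (A y)) x.

End fractional_operators.

Section minors.
Context {R : comPzRingType} {n k : nat}.

Definition submatrix (p q : 'I_k -> 'I_n) (F : 'M[R]_n) : 'M[R]_k :=
  mxsub p q F.

Definition zero_extension (p q : 'I_k -> 'I_n) (F : 'M[R]_k) : 'M[R]_n :=
  \matrix_(i, j)
    if [pick a | p a == i] is Some a then
      if [pick b | q b == j] is Some b then F a b else 0
    else 0.

Definition cof (A : 'M[R]_k) : 'M[R]_k := \matrix_(i, j) cofactor A i j.

End minors.

Lemma cofE (R : comPzRingType) k (A : 'M[R]_k) : cof A *m A^T = (\det A)%:M.
Proof.
rewrite -tr_scalar_mx -mul_mx_adj trmx_mul; congr (_ *m _).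
by apply/matrixP => i j; rewrite !mxE.
Qed.

Lemma cof1 (R : comPzRingType) (A : 'M[R]_1) : cof A = 1%:M.
Proof.
apply/matrixP => i j; rewrite !mxE /cofactor !ord1 det_mx00 mulr1 expr0.
by rewrite eqxx.
Qed.

(* Main.v *)
(** With [b = n + s - 1], integrating by parts against the truncated kernel
    [max(|z|, r)^-b], whose gradient is [-b z |z|^-(b+2)] outside the ball of
    radius [r] and 0 inside, shows that [D^s u] is a constant multiple of the
    gradient of the Riesz potential of [u] with kernel [|z|^-b]. So the entries
    of [cof M(D^s u)] are cofactors of an honest gradient, whose rows are
    divergence free by the classical Piola identity (the symmetry of second
    derivatives against the alternation of the determinant). In the truncated
    integral defining [Div^s], the value at [x] disappears because the kernel is
    odd, and a second integration by parts against the same truncated kernel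
    turns the rest into the integral of the kernel times the classical
    divergence. Hence every truncated integral vanishes, before any limit. *)

Require Import Defs.
From HB Require Import structures.
From mathcomp Require Import all_boot all_order fingroup perm all_algebra.
From mathcomp Require Import all_classical all_reals all_analysis.
From mathcomp Require Import measurable_realfun.
From mathcomp Require Import ring lra.

Set Implicit Arguments.
Unset Strict Implicit.
Unset Printing Implicit Defensive.

Import Order.TTheory GRing.Theory Num.Theory.
Import numFieldNormedType.Exports.

Local Open Scope classical_set_scope.
Local Open Scope ring_scope.

(** * Lebesgue measure on row vectors *)

(** The rows of [cof M(D^s u)] are not compactly supported: [D^s u] decays only like [|x|^-b], so an
    integration by parts over the whole space has to be paid for by decay. For [k >= 2] every term
    of a cofactor contains an entry of [D^s u], the truncated kernel brings a second factor of order
    [|z|^-b], and [2b > n] because [n >= k >= 2]. For [k = 1] the cofactor is the constant 1 and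
    nothing but the kernel decays; there the oddness of the kernel alone gives zero. Truncating by a
    maximum keeps the kernel continuous, so the sphere of radius [r] contributes no boundary term;
    only the gradient jumps there, on a null set. Derivatives of the potential always fall on [u],
    never on the singular kernel. *)

Lemma open_measurable_rV (R : realType) n (U : set 'rV[R]_n) :
  open U -> measurable U.
Proof.
move=> oU.
(* An open set is the countable union of the sup-norm balls with rational centre and radius
   [1/(m+1)] that it contains; each of them is a box, hence measurable for the coordinate
   sigma-algebra. *)
pose B (p : 'rV[rat]_n * nat) : set 'rV[R]_n :=
  [set x | forall i, ball (ratr (p.1 ord0 i) : R) p.2.+1%:R^-1 (x ord0 i)].
have mB p : measurable (B p).
  apply: (measurable_box (A := fun i => ball (ratr (p.1 ord0 i) : R) p.2.+1%:R^-1)).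
  by move=> i; apply: open_measurable; exact: ball_open.
have -> : U = \bigcup_p (if `[< B p `<=` U >] then B p else set0).
  apply/seteqP; split; last first.
    by move=> x [p _]; case: ifPn => // /asboolP; exact.
  move=> x Ux.
  have /nbhs_ballP[e /= e0 xeU] : nbhs x U by exact: open_nbhs_nbhs.
  have [m me] : exists m : nat, m.+1%:R^-1 < e / 2.
    have [m me] := ltr_add_invr (divr_gt0 e0 (@ltr0Sn R 1)).
    by exists m; rewrite add0r in me.
  have q0 i : {q : rat | ball (x ord0 i) m.+1%:R^-1 (ratr q : R)}.
    have m0 : x ord0 i - m.+1%:R^-1 < x ord0 i + m.+1%:R^-1.
      by rewrite ltrBlDr -addrA ltrDl addr_gt0// invr_gt0.
    apply/cid; have [q] := rat_in_itvoo m0; rewrite in_itv/= => /andP[q1 q2].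
    exists q; suff : `|x ord0 i - ratr q| < m.+1%:R^-1 by [].
    by rewrite ltr_distlC; apply/andP; split.
  exists (\row_i sval (q0 i), m) => //=; case: asboolP => [_|].
    by move=> i /=; rewrite mxE; apply: ball_sym; exact: (svalP (q0 i)).
  case=> y yB; apply: xeU; split => // i j; rewrite ord1.
  have := yB j; rewrite /= mxE => yj; have xj := svalP (q0 j).
  apply: (@le_ball _ _ _ (m.+1%:R^-1 + m.+1%:R^-1)).
    by rewrite [leRHS]splitr lerD// ltW.
  exact: ball_triangle xj yj.
apply: countable_bigcupT_measurable; first exact: countableP.
by move=> p; case: ifP.
Qed.

Lemma continuous_measurable_rV (R : realType) n (f : 'rV[R]_n -> R) :
  continuous f -> measurable_fun [set: 'rV[R]_n] f.
Proof.
move=> /continuousP cf; apply: (measurability _ (RGenOpens.measurableE R)).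
move=> _ [_ [a [b ->] <-]]; rewrite setTI.
by apply: open_measurable_rV; apply: cf; exact: interval_open.
Qed.

Lemma ge0_integral_rVS (R : realType) n (f : 'rV[R]_n.+1 -> \bar R) :
  measurable_fun [set: 'rV[R]_n.+1] f -> (forall x, 0 <= f x)%E ->
  (\int[lebesgue_rV n.+1]_x f x =
   \int[@lebesgue_measure R]_a \int[lebesgue_rV n]_v f (rV_cons (a, v)))%E.
Proof.
move=> mf f0.
have mc := @measurable_rV_cons R n.
rewrite [LHS](@ge0_integral_pushforward _ _ (measurableTypeR R * 'rV[R]_n)%type
  _ R (@rV_cons R n) mc (@lebesgue_measure R \x lebesgue_rV n)%E setT f)//.
rewrite preimage_setT; apply: (@fubini_tonelli1 _ _ (measurableTypeR R) 'rV[R]_n R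
  (@lebesgue_measure R) (lebesgue_rV n) (f \o @rV_cons R n)); first exact: measurableT_comp.
by move=> x; exact: f0.
Qed.

(** Translations and the reflection through the origin both act coordinate by coordinate, so their
    invariance reduces to dimension one. *)
Definition rVmap (R : realType) n (phi : 'I_n -> R -> R) (x : 'rV[R]_n) : 'rV[R]_n :=
  \row_i phi i (x ord0 i).

Lemma measurable_rVmap (R : realType) n (phi : 'I_n -> R -> R) :
  (forall i, measurable_fun [set: R] (phi i)) ->
  measurable_fun [set: 'rV[R]_n] (rVmap phi).
Proof.
move=> mphi; apply/measurable_fun_coordP => i.
under eq_fun do rewrite mxE.
by apply: measurableT_comp => //; exact: measurable_coord.
Qed.

(** Testing half-open intervals is enough: by uniqueness of Lebesgue measure they determine the
    image measure. *)
Definition lebesgue_preserving (R : realType) (phi : R -> R) : Prop :=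
  measurable_fun [set: R] phi /\
  forall X, ocitv X -> lebesgue_measure (phi @^-1` X) = lebesgue_measure X.

Lemma ge0_integral_preserving (R : realType) (phi : R -> R) (f : R -> \bar R) :
  lebesgue_preserving phi ->
  measurable_fun [set: measurableTypeR R] f -> (forall x, 0 <= f x)%E ->
  (\int[@lebesgue_measure R]_x f (phi x) = \int[@lebesgue_measure R]_x f x)%E.
Proof.
move=> [mphi phiE] mf f0.
have mphi' : measurable_fun [set: measurableTypeR R] (phi : _ -> measurableTypeR R) by [].
rewrite -[LHS](@ge0_integral_pushforward _ _ (measurableTypeR R)
  (measurableTypeR R) R phi mphi' (@lebesgue_measure R) setT f)//.
apply: eq_measure_integral => A mA _.
pose m : {measure set (measurableTypeR R) -> \bar R} :=
  pushforward (@lebesgue_measure R) (phi : measurableTypeR R -> measurableTypeR R).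
apply/esym; apply: (@lebesgue_measure_unique R (m mphi')) => //.
by move=> X oX; rewrite /= /pushforward phiE.
Qed.

(** Induction on the dimension: Tonelli splits off the first coordinate, where the one-dimensional
    invariance applies. *)
Lemma ge0_integral_rVmap (R : realType) n (phi : 'I_n -> R -> R)
    (f : 'rV[R]_n -> \bar R) :
  (forall i, lebesgue_preserving (phi i)) ->
  measurable_fun [set: 'rV[R]_n] f -> (forall x, 0 <= f x)%E ->
  (\int[lebesgue_rV n]_x f (rVmap phi x) = \int[lebesgue_rV n]_x f x)%E.
Proof.
elim: n phi f => [|n IHn] phi f hphi mf f0.
  apply: eq_integral => x _; congr (f _); apply/rowP; by case.
have mphi i : measurable_fun setT (phi i) by case: (hphi i).
have mfphi : measurable_fun setT (f \o rVmap phi).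
  by apply: measurableT_comp => //; exact: measurable_rVmap.
rewrite !ge0_integral_rVS//.
have mfc : measurable_fun setT (f \o @rV_cons R n).
  by apply: measurableT_comp => //; exact: measurable_rV_cons.
rewrite -[RHS](ge0_integral_preserving
  (f := fun a => \int[lebesgue_rV n]_v f (rV_cons (a, v)))%E (hphi ord0));
  last 2 first.
- apply: (@measurable_fun_fubini_tonelli_F _ _ (measurableTypeR R) 'rV[R]_n R
    (lebesgue_rV n) (f \o @rV_cons R n)) => //.
  by move=> x; exact: f0.
- by move=> a; exact: integral_ge0.
apply: eq_integral => a _.
rewrite -(IHn (fun i => phi (lift ord0 i)) (fun v => f (rV_cons (phi ord0 a, v))))//.
  apply: eq_integral => v _; congr (f _); apply/rowP => i; rewrite mxE.
  case: (unliftP ord0 i) => [j|] ->.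
    by rewrite !rV_consS/= mxE.
  by rewrite !rV_cons0.
apply: (measurableT_comp (f := f \o @rV_cons R n)) => //.
Qed.

Lemma integral_rVmap (R : realType) n (phi : 'I_n -> R -> R)
    (f : 'rV[R]_n -> \bar R) :
  (forall i, lebesgue_preserving (phi i)) ->
  measurable_fun [set: 'rV[R]_n] f ->
  (\int[lebesgue_rV n]_x f (rVmap phi x) = \int[lebesgue_rV n]_x f x)%E.
Proof.
move=> hphi mf; rewrite integralE [RHS]integralE.
congr (_ - _)%E.
  rewrite -[RHS](ge0_integral_rVmap (f := f^\+%E) hphi)//.
    by apply: eq_integral => x _; rewrite !funeposE.
  exact: measurable_funepos.
rewrite -[RHS](ge0_integral_rVmap (f := f^\-%E) hphi)//.
  by apply: eq_integral => x _; rewrite !funenegE.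
exact: measurable_funeneg.
Qed.

Lemma lebesgue_preserving_shift (R : realType) (a : R) :
  lebesgue_preserving (fun t => t + a).
Proof.
split; first exact: measurable_funD.
move=> _ [[b c] _ <-] /=.
have -> : (fun t => t + a) @^-1` `]b, c]%classic = `]b - a, c - a]%classic.
  by apply/seteqP; split => t /=; rewrite !in_itv/= ltrBlDr lerBrDr.
rewrite !lebesgue_measure_itv/= !lte_fin ltrD2r; case: ifPn => // bc.
by rewrite -!EFinB opprB addrA subrK.
Qed.

Lemma lebesgue_preserving_opp (R : realType) :
  lebesgue_preserving (fun t : R => - t).
Proof.
split; first exact: oppr_measurable.
move=> _ [[b c] _ <-] /=.
have -> : (fun t => - t) @^-1` `]b, c]%classic = `[- c, - b[%classic.
  apply/seteqP; split => t /=; rewrite !in_itv/= => /andP[h1 h2]; apply/andP; split; lra.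
rewrite !lebesgue_measure_itv/= !lte_fin ltrN2; case: ifPn => // bc.
by rewrite -!EFinB opprK addrC.
Qed.

Lemma integral_rV_shift (R : realType) n (a : 'rV[R]_n) (f : 'rV[R]_n -> \bar R) :
  measurable_fun [set: 'rV[R]_n] f ->
  (\int[lebesgue_rV n]_x f (x + a)%R = \int[lebesgue_rV n]_x f x)%E.
Proof.
move=> mf; rewrite -[RHS](@integral_rVmap _ _ (fun i t => t + a ord0 i))//.
  by apply: eq_integral => x _; congr (f _); apply/rowP => i; rewrite !mxE.
by move=> i; exact: lebesgue_preserving_shift.
Qed.

Lemma integral_rV_opp (R : realType) n (f : 'rV[R]_n -> \bar R) :
  measurable_fun [set: 'rV[R]_n] f ->
  (\int[lebesgue_rV n]_x f (- x)%R = \int[lebesgue_rV n]_x f x)%E.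
Proof.
move=> mf; rewrite -[RHS](@integral_rVmap _ _ (fun i t => - t))//.
  by apply: eq_integral => x _; congr (f _); apply/rowP => i; rewrite !mxE.
by move=> i; exact: lebesgue_preserving_opp.
Qed.

(** * Sup norm, Euclidean norm, cubes and spheres *)

Lemma coord_le_norm (R : realType) n (y : 'rV[R]_n) i : `|y ord0 i| <= `|y|.
Proof.
rewrite [leRHS]/Num.Def.normr/= mx_normrE.
exact: (le_bigmax _ (fun ij : 'I_1 * 'I_n => `|y ij.1 ij.2|) (ord0, i)).
Qed.

Lemma rV_norm_leP (R : realType) n (y : 'rV[R]_n) r : 0 <= r ->
  `|y| <= r <-> forall i, `|y ord0 i| <= r.
Proof.
move=> r0; split=> [yr i|yr]; first exact: le_trans (coord_le_norm y i) yr.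
rewrite [leLHS]/Num.Def.normr/= mx_normrE; apply: bigmax_le => //= -[i j] _ /=.
by rewrite ord1.
Qed.

Lemma enorm_ge0 (R : realType) n (y : 'rV[R]_n) : 0 <= enorm y.
Proof. exact: sqrtr_ge0. Qed.

Lemma sqr_enorm (R : realType) n (y : 'rV[R]_n) :
  enorm y ^+ 2 = \sum_i y ord0 i ^+ 2.
Proof. by rewrite sqr_sqrtr// sumr_ge0// => i _; exact: sqr_ge0. Qed.

Lemma norm_le_enorm (R : realType) n (y : 'rV[R]_n) : `|y| <= enorm y.
Proof.
apply/rV_norm_leP => [|i]; first exact: enorm_ge0.
rewrite -sqrtr_sqr ler_wsqrtr// (bigD1 i)//= lerDl sumr_ge0// => j _.
exact: sqr_ge0.
Qed.

Lemma enormN (R : realType) n (y : 'rV[R]_n) : enorm (- y) = enorm y.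
Proof.
by congr Num.sqrt; apply: eq_bigr => i _; rewrite mxE sqrrN.
Qed.

Lemma measurable_enorm (R : realType) n :
  measurable_fun [set: 'rV[R]_n] (@enorm R n).
Proof.
apply: measurableT_comp.
  by apply: continuous_measurable_fun; exact: sqrt_continuous.
apply: measurable_sum => i; apply: measurable_funX.
exact: measurable_coord.
Qed.

Lemma measurable_rV_norm (R : realType) n :
  measurable_fun [set: 'rV[R]_n] (fun y : 'rV[R]_n => `|y|).
Proof. by apply: continuous_measurable_rV => y; exact: norm_continuous. Qed.

Lemma measurable_norm_le (R : realType) n (r : R) :
  measurable [set y : 'rV[R]_n | `|y| <= r].
Proof.
rewrite -[X in measurable X]setTI.
have -> : [set y : 'rV[R]_n | `|y| <= r] = (fun y => `|y|) @^-1` `]-oo, r].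
  by apply/seteqP; split => y /=; rewrite in_itv.
exact: measurable_rV_norm.
Qed.

Lemma lebesgue_rV_norm_le (R : realType) n (r : R) : 0 <= r ->
  lebesgue_rV n [set y : 'rV[R]_n | `|y| <= r] = ((2 * r) ^+ n)%:E.
Proof.
move=> r0.
have -> : [set y : 'rV[R]_n | `|y| <= r] =
    [set y | forall i, `[- r, r]%classic (y ord0 i)].
  apply/seteqP; split => y /=.
    by move=> /(rV_norm_leP y r0) yr i; rewrite in_itv/= -ler_norml.
  move=> yr; apply/rV_norm_leP => // i.
  by have := yr i; rewrite in_itv/= -ler_norml.
rewrite (lebesgue_rV_box (A := fun=> `[- r, r]%classic))//.
have mI : lebesgue_measure (`[- r, r]%classic : set R) = (2 * r)%:E.
  rewrite lebesgue_measure_itv/= lte_fin; case: ifPn => [_|].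
    by rewrite -EFinD opprK -mulr2n mulr_natl.
  by rewrite -leNgt => r1; rewrite (_ : r = 0) ?mulr0//; lra.
under eq_bigr do rewrite mI.
by rewrite prodEFin prodr_const card_ord.
Qed.

Lemma enorm_rV_cons (R : realType) n (a : R) (v : 'rV[R]_n) :
  enorm (rV_cons (a, v)) = Num.sqrt (a ^+ 2 + \sum_i v ord0 i ^+ 2).
Proof.
rewrite /enorm big_ord_recl rV_cons0; congr (Num.sqrt (_ + _)).
by apply: eq_bigr => i _; rewrite rV_consS.
Qed.

Lemma measurable_sphere (R : realType) n (r : R) :
  measurable [set y : 'rV[R]_n | enorm y = r].
Proof.
rewrite -[X in measurable X]setTI.
exact: (@measurable_enorm R n measurableT [set r] (measurable_set1 r)).
Qed.

(* On each line parallel to the first axis the sphere has at most two points. *)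
Lemma sphere_null (R : realType) n (r : R) :
  lebesgue_rV n.+1 [set y : 'rV[R]_n.+1 | enorm y = r] = 0%E.
Proof.
set S := [set y | _].
have mS : measurable S by exact: measurable_sphere.
rewrite -[S]setIT -integral_indic// ge0_integral_rVS//; last first.
  exact/measurable_EFinP/measurable_indic.
pose f : measurableTypeR R * 'rV[R]_n -> \bar R :=
  fun p => (\1_S (rV_cons p))%:E.
have mf : measurable_fun setT f.
  apply: (measurableT_comp (f := fun y => (\1_S y)%:E)).
    exact/measurable_EFinP/measurable_indic.
  exact: measurable_rV_cons.
(* Tonelli in the other order, so that the first coordinate is integrated before the remaining
   ones. *)
transitivity (\int[lebesgue_rV n]_v \int[@lebesgue_measure R]_a f (a, v))%E.
  apply: (@fubini_tonelli _ _ (measurableTypeR R) 'rV[R]_n R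
    (@lebesgue_measure R) (lebesgue_rV n) f) => //.
  by move=> p; rewrite /f lee_fin.
apply: integral0_eq => v _.
pose c := \sum_i v ord0 i ^+ 2.
pose t := Num.sqrt (r ^+ 2 - c).
have mt : measurable ([set t; - t] : set (measurableTypeR R)).
  by apply: measurableU; exact: measurable_set1.
have t0 : lebesgue_measure ([set t; - t] : set (measurableTypeR R)) = 0%E.
  by apply: countable_lebesgue_measure0; exact: finite_set_countable.
apply/eqP; rewrite eq_le integral_ge0 ?andbT; last first.
  by move=> a _; rewrite /f lee_fin.
rewrite -t0 -[X in lebesgue_measure X]setIT -integral_indic//.
apply: ge0_le_integral => //.
- by move=> a _; rewrite /f lee_fin.
- exact: (@measurableT_comp _ _ _ _ _ _ f _ (fun a => (a, v))).
- exact/measurable_EFinP/measurable_indic.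
move=> a _; rewrite /f lee_fin !indicE ler_nat.
case: (boolP (rV_cons (a, v) \in S)) => // /[!inE].
rewrite /S/= enorm_rV_cons -/c => ar.
have : `|a| = t.
  rewrite /t -ar sqr_sqrtr ?addrK ?sqrtr_sqr// addr_ge0 ?sqr_ge0//.
  by rewrite sumr_ge0// => i _; exact: sqr_ge0.
have pm (b : R) : `|b| = t -> b = t \/ b = - t.
  by case: (ger0P b) => _ bt; [left|right; rewrite -bt opprK].
by move=> /pm at_; rewrite mem_set.
Qed.


(** * Integrability of powers by dyadic domination *)

Lemma dyadic_bracket (R : realType) (t : R) : 1 <= t ->
  exists m : nat, 2 ^+ m <= t < 2 ^+ m.+1.
Proof.
move=> t1.
have ex : exists N : nat, t < 2 ^+ N.
  exists (Num.bound t); apply: lt_le_trans (archi_boundP (le_trans ler01 t1)) _.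
  by rewrite -natrX ler_nat ltnW// ltn_expl.
case: (ex_minnP ex) => -[|m] tm mmin.
  by move: tm; rewrite expr0 ltNge t1.
by exists m; rewrite tm andbT leNgt; apply/negP => /mmin; rewrite ltnn.
Qed.

(* [g] is dominated by the sum of [c m] times the indicator of the cube of
   radius [rho m], whose measure is [(2 * rho m) ^+ n]. *)
Lemma dyadic_integrable (R : realType) n (g : 'rV[R]_n -> R) (c rho : nat -> R)
    (A z : R) :
  measurable_fun [set: 'rV[R]_n] g -> (forall y, 0 <= g y) ->
  (forall m, 0 <= c m) -> (forall m, 0 <= rho m) -> 0 <= z < 1 ->
  (forall y, g y != 0 -> exists2 m, `|y| <= rho m & g y <= c m) ->
  (forall m, c m * (2 * rho m) ^+ n <= A * z ^+ m) ->
  (lebesgue_rV n).-integrable setT (EFin \o g).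
Proof.
move=> mg g0 c0 rho0 /andP[z0 z1] gc cz.
apply/integrableP; split; first exact/measurable_EFinP.
under eq_integral => y _ do rewrite /= ger0_norm//.
pose B m : set 'rV[R]_n := [set y | `|y| <= rho m].
have mB m : measurable (B m) by exact: measurable_norm_le.
pose f m (y : 'rV[R]_n) := (c m * \1_(B m) y)%:E.
have f0 m y : (0 <= f m y)%E by rewrite /f lee_fin mulr_ge0.
have mf m : measurable_fun setT (f m).
  by apply/measurable_EFinP; apply: measurable_funM => //; exact: measurable_indic.
apply: (@le_lt_trans _ _ (\int[lebesgue_rV n]_y \sum_(0 <= m <oo) f m y)%E).
  apply: ge0_le_integral => //.
  - by move=> y _; rewrite lee_fin.
  - exact/measurable_EFinP.
  - exact: ge0_emeasurable_sum.
  move=> y _; have [->|/gc[m ym gm]] := eqVneq (g y) 0.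
    by apply: nneseries_ge0 => m _ _.
  apply: le_trans (nneseries_lim_ge (u_ := f ^~ y) (P := xpredT) (m := 0) m.+1 _) => //.
  rewrite big_nat_recr//= -[leLHS]add0e; apply: leeD.
    by apply: sume_ge0.
  by rewrite /f lee_fin indicE mem_set// mulr1.
rewrite integral_nneseries//.
apply: (@le_lt_trans _ _ (\sum_(0 <= m <oo) (geometric A z m)%:E)%E).
  apply: lee_nneseries => [m _ _|m _]; first exact: integral_ge0.
  rewrite /f (integralZl_indic measurableT (fun=> B m))//; last by move=> /lt_geF; rewrite c0.
  have -> : (\int[lebesgue_rV n]_y (\1_(B m) y)%:E)%E = ((2 * rho m) ^+ n)%:E.
    by rewrite integral_indic// setIT; exact: lebesgue_rV_norm_le.
  by rewrite -EFinM lee_fin.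
under eq_fun do rewrite sumEFin.
have cvgz : cvgn (series (geometric A z)).
  by apply: is_cvg_geometric_series; rewrite ger0_norm.
by rewrite (EFin_lim cvgz) ltry.
Qed.

Lemma powR2_lt1 (R : realType) (x : R) : x < 0 -> 2 `^ x < 1.
Proof.
move=> x0; rewrite -[x]opprK powRN invf_lt1 ?powR_gt0//.
suff : 1 `^ (- x) < 2 `^ (- x) by rewrite powR1.
apply: gt0_ltr_powR; rewrite ?oppr_gt0 ?nnegrE ?ler01 ?ler0n ?ltr1n //.
Qed.

(** The common yardstick for decay at infinity. It uses the sup norm because cubes have explicit
    measure, and it is positive everywhere. *)
Definition weight (R : realType) n (a : R) (y : 'rV[R]_n) : R :=
  (1 + `|y|) `^ (- a).

Lemma weight_gt0 (R : realType) n (a : R) (y : 'rV[R]_n) : 0 < weight a y.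
Proof. by rewrite powR_gt0// ltr_pwDl. Qed.

Lemma weight_ge0 (R : realType) n (a : R) (y : 'rV[R]_n) : 0 <= weight a y.
Proof. exact/ltW/weight_gt0. Qed.

Lemma weightD (R : realType) n (a b : R) (y : 'rV[R]_n) :
  weight (a + b) y = weight a y * weight b y.
Proof.
rewrite /weight opprD powRD//; apply/implyP => _.
by rewrite gt_eqF// ltr_pwDl.
Qed.

Lemma weight_le1 (R : realType) n (a : R) (y : 'rV[R]_n) : 0 <= a -> weight a y <= 1.
Proof.
move=> a0; rewrite /weight powRN invf_le1 ?powR_gt0 ?ltr_pwDl//.
have := @ler_powR _ (1 + `|y|) _ 0 a a0; rewrite powRr0; apply.
by rewrite lerDl.
Qed.

Lemma measurable_weight (R : realType) n (a : R) :
  measurable_fun [set: 'rV[R]_n] (weight a).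
Proof.
apply: (@measurableT_comp _ _ _ _ _ _ (fun t : R => t `^ (- a)) _
  (fun y : 'rV[R]_n => 1 + `|y|)); first exact: measurable_powR.
by apply: measurable_funD => //; exact: measurable_rV_norm.
Qed.

(** On the shell [2^m <= 1 + |y| < 2^(m+1)] the weight is at most [2^(-a m)], and the enclosing cube
    has measure [(4 * 2^m)^n]; the resulting geometric series has ratio [2^(n-a) < 1]. *)
Lemma weight_integrable (R : realType) n (a : R) : n%:R < a ->
  (lebesgue_rV n).-integrable setT (EFin \o @weight R n a).
Proof.
move=> na.
apply: (@dyadic_integrable R n _ (fun m => (2 `^ (- a)) ^+ m)
  (fun m => 2 ^+ m.+1) (4 ^+ n) (2 `^ (- a) * 2 ^+ n)).
- exact: measurable_weight.
- exact: weight_ge0.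
- by move=> m; rewrite exprn_ge0// powR_ge0.
- by move=> m; rewrite exprn_ge0.
- rewrite mulr_ge0 ?powR_ge0 ?exprn_ge0//=.
  rewrite -powR_mulrn// -powRD ?pnatr_eq0 ?implybT//.
  by rewrite powR2_lt1// addrC subr_lt0.
- move=> y _.
  have [m /andP[m1 m2]] : exists m : nat, 2 ^+ m <= 1 + `|y| < 2 ^+ m.+1.
    by apply: dyadic_bracket; rewrite lerDl.
  exists m; first by apply: le_trans (ltW m2); rewrite lerDr.
  rewrite /weight -powR_mulrn ?powR_ge0// powRAC powR_mulrn//.
  rewrite !powRN lef_pV2 ?posrE ?powR_gt0 ?exprn_gt0 ?ltr_pwDl//.
  rewrite ge0_ler_powR// ?nnegrE ?exprn_ge0 ?addr_ge0//.
  by apply: le_trans (ltW na).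
- move=> m; have -> : 2 * 2 ^+ m.+1 = 4 * 2 ^+ m :> R by rewrite exprS; ring.
  by rewrite !exprMn -!exprM mulrCA [(m * n)%N]mulnC.
Qed.

(** On the shell [2^-(m+1) < |y| <= 2^-m] the power is at most [2^((m+1) b)], and the enclosing cube
    has measure [(2 * 2^-m)^n]; the ratio of the series is [2^(b-n) < 1]. *)
Lemma local_powR_integrable (R : realType) n (b : R) : 0 < b < n%:R ->
  (lebesgue_rV n).-integrable setT
    (fun y : 'rV[R]_n => (if `|y| <= 1 then `|y| `^ (- b) else 0)%:E).
Proof.
move=> /andP[b0 bn].
apply: (@dyadic_integrable R n _ (fun m => (2 ^+ m.+1) `^ b)
  (fun m => 2 ^- m) (2 `^ b * 2 ^+ n) (2 `^ b * 2 ^- n)).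
- apply: measurable_fun_ifT => //.
    by apply: measurable_fun_ler => //; exact: measurable_rV_norm.
  apply: (@measurableT_comp _ _ _ _ _ _ (fun t : R => t `^ (- b)) _
    (fun y : 'rV[R]_n => `|y|)); first exact: measurable_powR.
  exact: measurable_rV_norm.
- by move=> y; case: ifP => // _; exact: powR_ge0.
- by move=> m; exact: powR_ge0.
- by move=> m; rewrite invr_ge0 exprn_ge0.
- rewrite mulr_ge0 ?powR_ge0 ?invr_ge0 ?exprn_ge0//=.
  rewrite -powR_invn// -powRD ?pnatr_eq0 ?implybT//.
  by rewrite powR2_lt1// subr_lt0.
- move=> y; case: ifPn => [y1|]; last by rewrite eqxx.
  (* At the origin the power takes the default value 0, which the assumption of a nonzero value
     excludes. *)
  have [->|y0 _] := eqVneq y 0.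
    by rewrite normr0 powR0 ?eqxx// oppr_eq0 gt_eqF.
  have yp : 0 < `|y| by rewrite normr_gt0.
  have [m /andP[m1 m2]] : exists m : nat, 2 ^+ m <= `|y|^-1 < 2 ^+ m.+1.
    by apply: dyadic_bracket; rewrite invf_ge1.
  exists m; first by rewrite -[leLHS]invrK lef_pV2 ?posrE ?exprn_gt0 ?invr_gt0.
  rewrite powRN -powR_inv1 ?powR_ge0// -powRrM mulrN1 -mulN1r powRrM powR_inv1//.
  by rewrite ge0_ler_powR// ?nnegrE ?invr_ge0 ?exprn_ge0// ltW.
- move=> m; rewrite -[2 ^+ m.+1]powR_mulrn// powRAC powR_mulrn ?powR_ge0//.
  rewrite exprS !exprMn !exprVn -!exprM [(m * n)%N]mulnC.
  by rewrite -!mulrA ler_pM2l ?powR_gt0// mulrCA.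
Qed.

(** * Integration by parts *)

Lemma dominated_convergence_Rintegral d (T : measurableType d) (R : realType)
    (mu : {measure set T -> \bar R}) (f_ : (T -> R)^nat) (f g : T -> R) :
  (forall k, measurable_fun setT (f_ k)) -> measurable_fun setT f ->
  {ae mu, forall x, f_ ^~ x @ \oo --> f x} ->
  mu.-integrable setT (EFin \o g) -> {ae mu, forall x k, `|f_ k x| <= g x} ->
  mu.-integrable setT (EFin \o f) /\
  (\int[mu]_x f_ k x @[k --> \oo] --> \int[mu]_x f x).
Proof.
move=> mf_ mf f_f ig f_g.
have [| | | | |intf _ cvgf] := @dominated_convergence _ _ _ mu setT measurableT
  (fun k => EFin \o f_ k) (EFin \o f) (EFin \o g).
- by move=> k; exact/measurable_EFinP.
- exact/measurable_EFinP.
- apply: filterS f_f => x f_fx _; apply: cvg_EFin => //.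
  exact: nearW.
- exact: ig.
- by apply: filterS f_g => x f_gx k _; rewrite lee_fin.
split=> //; rewrite /Rintegral; apply: fine_cvg.
by rewrite fineK//; exact: integrable_fin_num.
Qed.

Lemma le_integrable_R d (T : measurableType d) (R : realType)
    (mu : {measure set T -> \bar R}) (D : set T) (f g : T -> R) :
  measurable D -> measurable_fun D f -> (forall x, D x -> `|f x| <= g x) ->
  mu.-integrable D (EFin \o g) -> mu.-integrable D (EFin \o f).
Proof.
move=> mD mf fg; apply: le_integrable => //; first exact/measurable_EFinP.
move=> x Dx /=; rewrite lee_fin (le_trans (fg _ Dx))//; exact: ler_norm.
Qed.

Lemma is_derive_seq (R : realType) (V : normedModType R) (f : V -> R) y v l
    (t : R^nat) :
  is_derive y v f l -> (forall k, t k != 0) -> t @ \oo --> (0 : R) ->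
  (f (y + t k *: v) - f y) / t k @[k --> \oo] --> l.
Proof.
move=> [fd <-] t0 tcvg.
have /cvgr_dnbhsP := fd; move=> /(_ t (conj t0 tcvg)).
set F := (X in X @ _ --> _); set G := (X in _ -> X @ _ --> _).
suff -> : F = G by [].
by apply/funext => k; rewrite /F/G/= [y + _]addrC [LHS]mulrC.
Qed.

(** Together with the converse [is_derive_of_line], this reduces directional derivatives to one real
    variable, where the chain rule and the mean value theorem apply. *)
Lemma is_derive_line (R : realType) (V : normedModType R) (f : V -> R) y v l (t : R) :
  is_derive (y + t *: v) v f l -> is_derive t 1 (fun s => f (y + s *: v)) l.
Proof.
move=> [fd fl].
have E : (fun h : R => h^-1 *:
      (((fun s : R => f (y + s *: v)) \o shift t) (h *: 1) - f (y + t *: v))) =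
    (fun h : R => h^-1 *: ((f \o shift (y + t *: v)) (h *: v) - f (y + t *: v))).
  apply/funext => h /=; congr (_ *: (f _ - _)).
  by rewrite [h *: 1]mulr1 scalerDl addrCA.
split; first by rewrite /derivable E.
by rewrite -fl /derive E.
Qed.

Lemma measurable_rV_add (R : realType) n (a : 'rV[R]_n) (f : 'rV[R]_n -> R) :
  measurable_fun [set: 'rV[R]_n] f -> measurable_fun [set: 'rV[R]_n] (fun y => f (y + a)).
Proof.
move=> mf; apply: (measurableT_comp (g := fun y : 'rV[R]_n => y + a)) => //.
apply/measurable_fun_coordP => i; under eq_fun do rewrite mxE.
by apply: measurable_funD => //; exact: measurable_coord.
Qed.

Lemma Rintegral_rV_shift (R : realType) n (a : 'rV[R]_n) (f : 'rV[R]_n -> R) :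
  measurable_fun [set: 'rV[R]_n] f ->
  \int[lebesgue_rV n]_x f (x + a) = \int[lebesgue_rV n]_x f x.
Proof.
move=> mf; rewrite /Rintegral; congr fine.
rewrite -[RHS](integral_rV_shift a)//; exact/measurable_EFinP.
Qed.

(* Translation invariance gives the identity with difference quotients in place
   of both derivatives; dominated convergence then lets the step tend to 0. An
   almost everywhere derivative of [g] suffices, as required by truncated
   kernels, which are not differentiable on a sphere. *)
Section integration_by_parts.
Context {R : realType} {n : nat}.
Variables (e : 'rV[R]_n) (f df g dg H1 H2 : 'rV[R]_n -> R).
Local Notation mu := (lebesgue_rV n).
Hypotheses (mf : measurable_fun setT f) (mdf : measurable_fun setT df)
  (mg : measurable_fun setT g) (mdg : measurable_fun setT dg).
Hypotheses (derf : forall y : 'rV[R]_n, is_derive y e f (df y))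
  (derg : {ae mu, forall y : 'rV[R]_n, is_derive y e g (dg y)}).
Hypotheses (fH : forall y, `|f y| <= H1 y) (gH : forall y, `|g y| <= H2 y).
Hypotheses
  (dfH : forall (y : 'rV[R]_n) (t : R), `|t| <= 1 ->
    `|f (y + t *: e) - f y| <= H1 y * `|t|)
  (dgH : forall (y : 'rV[R]_n) (t : R), `|t| <= 1 ->
    `|g (y + t *: e) - g y| <= H2 y * `|t|).
Hypothesis intH : mu.-integrable setT (fun y : 'rV[R]_n => (H1 y * H2 y)%:E).

Let t (k : nat) : R := k.+1%:R^-1.

Let t_gt0 k : 0 < t k. Proof. by rewrite invr_gt0. Qed.

Let t_le1 k : `|t k| <= 1.
Proof. by rewrite gtr0_norm// invf_le1// ler1n. Qed.

Let tN_le1 k : `|- t k| <= 1. Proof. by rewrite normrN. Qed.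

Let t_neq0 k : t k != 0. Proof. exact: lt0r_neq0. Qed.

Let tcvg : t @ \oo --> (0 : R). Proof. exact: cvg_harmonic. Qed.

Let H1_ge0 y : 0 <= H1 y. Proof. exact: le_trans (fH y). Qed.
Let H2_ge0 y : 0 <= H2 y. Proof. exact: le_trans (gH y). Qed.

Lemma integration_by_parts_rV :
  [/\ mu.-integrable setT (fun y : 'rV[R]_n => (f y * dg y)%:E),
      mu.-integrable setT (fun y : 'rV[R]_n => (df y * g y)%:E) &
      \int[mu]_y (f y * dg y) = - \int[mu]_y (df y * g y)].
Proof.
have mft k : measurable_fun setT (fun y : 'rV[R]_n => f (y + - t k *: e)).
  exact: measurable_rV_add.
have mgt k : measurable_fun setT (fun y : 'rV[R]_n => g (y + t k *: e)).
  exact: measurable_rV_add.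
pose A k (y : 'rV[R]_n) : R := f y * ((g (y + t k *: e) - g y) / t k).
(* The step is [- t k] because the translation that frees [g] of its increment moves [f] the
   opposite way. *)
pose B k (y : 'rV[R]_n) : R := (f (y + - t k *: e) - f y) / (- t k) * g y.
have [||||intA cvgA] := @dominated_convergence_Rintegral _ _ R mu A
    (fun y : 'rV[R]_n => f y * dg y) (fun y : 'rV[R]_n => H1 y * H2 y) _ _ _ intH.
- move=> k; apply: measurable_funM => //; apply: measurable_funM => //.
  exact: measurable_funB.
- exact: measurable_funM.
- apply: filterS derg => y dery; apply: cvgM; first exact: cvg_cst.
  exact: is_derive_seq.
- apply: aeW => y k; rewrite normrM ler_pM// normrM normfV ler_pdivrMr ?normr_gt0//.
  exact: dgH.
have [||||intB cvgB] := @dominated_convergence_Rintegral _ _ R mu B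
    (fun y : 'rV[R]_n => df y * g y) (fun y : 'rV[R]_n => H1 y * H2 y) _ _ _ intH.
- move=> k; apply: measurable_funM => //; apply: measurable_funM => //.
  exact: measurable_funB.
- exact: measurable_funM.
- apply: aeW => y; apply: cvgM; last exact: cvg_cst.
  apply: (is_derive_seq (t := fun k => - t k)) => //.
    by move=> k; rewrite oppr_eq0.
  by rewrite -oppr0; apply: cvgN.
- apply: aeW => y k; rewrite normrM ler_pM// normrM normfV ler_pdivrMr.
    exact: dfH.
  by rewrite normrN normr_gt0.
split=> //.
have AB k : \int[mu]_y A k y = - \int[mu]_y B k y.
  have ifg : mu.-integrable setT (EFin \o (fun y : 'rV[R]_n => f y * g y)).
    apply: le_integrable_R intH => //; first exact: measurable_funM.
    by move=> y _; rewrite normrM ler_pM.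
  have ifgt : mu.-integrable setT (EFin \o (fun y : 'rV[R]_n => f y * g (y + t k *: e))).
    (* The factor 2: the shifted value is the value at [y] plus an increment, and [H2 y] bounds each
       of them. *)
    apply: (@le_integrable_R _ _ _ _ _ _ (fun y : 'rV[R]_n => 2 * (H1 y * H2 y))) => //.
    - exact: measurable_funM.
    - move=> y _; rewrite normrM mulrCA ler_pM//.
      rewrite -[g _](subrK (g y)) (le_trans (ler_normD _ _))// mulr_natl mulr2n.
      rewrite lerD// (le_trans (dgH _ _))// -[leRHS]mulr1 ler_wpM2l//.
    exact: (integrableZl measurableT 2 intH).
  have iftg : mu.-integrable setT (EFin \o (fun y : 'rV[R]_n => f (y + - t k *: e) * g y)).
    apply: (@le_integrable_R _ _ _ _ _ _ (fun y : 'rV[R]_n => 2 * (H1 y * H2 y))) => //.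
    - exact: measurable_funM.
    - move=> y _; rewrite normrM mulrA ler_pM//.
      rewrite -[f (_ + _)](subrK (f y)) (le_trans (ler_normD _ _))// mulr_natl mulr2n.
      rewrite lerD// (le_trans (dfH _ _))// -[leRHS]mulr1 ler_wpM2l//.
    exact: (integrableZl measurableT 2 intH).
  transitivity ((\int[mu]_y (f y * g (y + t k *: e)) - \int[mu]_y (f y * g y)) * (t k)^-1).
    rewrite -RintegralB// -RintegralZr//; last first.
      exact: (integrableB measurableT ifgt ifg).
    by apply: eq_Rintegral => y _; rewrite /A mulrA mulrBr.
  have -> : \int[mu]_y (f y * g (y + t k *: e)) =
      \int[mu]_y (f (y + - t k *: e) * g y).
    rewrite -[LHS](Rintegral_rV_shift (- t k *: e)); last exact: measurable_funM.
    apply: eq_Rintegral => y _.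
    by rewrite -addrA -scalerDl addNr scale0r addr0.
  rewrite -RintegralB//.
  have iB : mu.-integrable setT
      (EFin \o (fun y : 'rV[R]_n => f (y + - t k *: e) * g y - f y * g y)).
    exact: (integrableB measurableT iftg ifg).
  rewrite -RintegralZr// -[RHS]mulN1r -[RHS]mulrC.
  have -> : \int[mu]_y B k y =
      \int[mu]_y ((f (y + - t k *: e) * g y - f y * g y) * (- t k)^-1).
    by apply: eq_Rintegral => y _; rewrite /B -mulrBl mulrAC.
  rewrite -RintegralZr//; last exact: (integrableZr measurableT (- t k)^-1 iB).
  by apply: eq_Rintegral => y _; rewrite invrN; ring.
have cvgB' : \int[mu]_y A k y @[k --> \oo] --> - \int[mu]_y (df y * g y).
  by under eq_fun do rewrite AB; exact: cvgN.
exact: (cvg_unique _ cvgA cvgB').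
Qed.

End integration_by_parts.

(** * Riesz kernels *)

Lemma is_derive_of_line (R : realType) (V : normedModType R) (f : V -> R) y v l :
  is_derive (0 : R) 1 (fun s => f (y + s *: v)) l -> is_derive y v f l.
Proof.
move=> [fd fl].
have E : (fun h : R => h^-1 *: ((f \o shift y) (h *: v) - f y)) =
  (fun h : R => h^-1 *: (((fun s : R => f (y + s *: v)) \o shift 0) (h *: 1)
                         - f (y + 0 *: v))).
  apply/funext => h /=; congr (_ *: (f _ - f _)); last by rewrite scale0r addr0.
  by rewrite [h *: 1]mulr1 addr0 addrC.
split; first by rewrite /derivable E.
by rewrite -fl /derive E.
Qed.

Lemma norm_scale_delta (R : realType) n (j : 'I_n) (t : R) :
  `|t *: (delta_mx ord0 j : 'rV[R]_n)| <= `|t|.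
Proof.
apply/rV_norm_leP => // i; rewrite !mxE eqxx/=.
by case: eqP => _; rewrite ?mulr1// mulr0 normr0.
Qed.

Lemma norm_delta_le1 (R : realType) n (j : 'I_n) :
  `|delta_mx ord0 j : 'rV[R]_n| <= 1.
Proof. by have := norm_scale_delta j (1 : R); rewrite scale1r normr1. Qed.

Lemma enorm_shift_sqr (R : realType) n (z : 'rV[R]_n) (j : 'I_n) (t : R) :
  enorm (z + t *: delta_mx ord0 j) ^+ 2 =
  enorm z ^+ 2 + (2 * t * z ord0 j + t ^+ 2).
Proof.
rewrite !sqr_enorm (bigD1 j)//= [in RHS](bigD1 j)//= addrAC; congr (_ + _).
  by rewrite !mxE !eqxx/= mulr1; ring.
by apply: eq_bigr => i ij; rewrite !mxE (negbTE ij) andbF mulr0 addr0.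
Qed.

Lemma coord_le_enorm (R : realType) n (z : 'rV[R]_n) j : `|z ord0 j| <= enorm z.
Proof. exact: le_trans (coord_le_norm z j) (norm_le_enorm z). Qed.

(** Along a coordinate axis the triangle inequality follows from [|z_j| <= enorm z], in place of
    Cauchy-Schwarz. *)
Lemma enorm_shift_le (R : realType) n (z : 'rV[R]_n) (j : 'I_n) (t : R) :
  enorm (z + t *: delta_mx ord0 j) <= enorm z + `|t|.
Proof.
rewrite -ler_sqr ?nnegrE ?addr_ge0 ?enorm_ge0// enorm_shift_sqr sqrrD.
rewrite real_normK ?num_real// -addrA lerD2l lerD2r -mulrA mulr_natl lerMn2r/=.
rewrite (le_trans (ler_norm _))// normrM mulrC ler_wpM2r//.
exact: coord_le_enorm.
Qed.

Lemma enorm_shift_dist (R : realType) n (z : 'rV[R]_n) (j : 'I_n) (t : R) :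
  `|enorm (z + t *: delta_mx ord0 j) - enorm z| <= `|t|.
Proof.
rewrite ler_distl; apply/andP; split; last exact: enorm_shift_le.
have := enorm_shift_le (z + t *: delta_mx ord0 j) j (- t).
by rewrite -addrA -scalerDl subrr scale0r addr0 normrN lerBlDr.
Qed.

Lemma maxr_dist (R : realType) (x y r : R) :
  `|Num.max x r - Num.max y r| <= `|x - y|.
Proof.
wlog xy : x y / x <= y => [h|].
  by case: (leP x y) => [/h//|/ltW/h]; rewrite distrC [leRHS]distrC.
have mxy : Num.max x r <= Num.max y r by rewrite ge_max !le_max xy lexx orbT.
rewrite distrC [leRHS]distrC !ger0_norm ?subr_ge0//.
by case: (leP y r) mxy => yr; case: (leP x r) => xr mxy; lra.
Qed.

(* At the origin the value is the junk [0 `^ (- b) = 0]. *)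
Definition riesz (R : realType) n (b : R) (z : 'rV[R]_n) : R := enorm z `^ (- b).

Definition truncated_riesz (R : realType) n (b r : R) (z : 'rV[R]_n) : R :=
  Num.max (enorm z) r `^ (- b).

(* Up to the factor [- b], the [j]-th partial derivative of [riesz b]; for
   [b = n + s - 1] it is the kernel of the fractional gradient. *)
Definition riesz_grad (R : realType) n (b : R) (j : 'I_n) (z : 'rV[R]_n) : R :=
  (z ord0 j / enorm z) / enorm z `^ (b + 1).

Lemma is_derive_powR (R : realType) (a x : R) : 0 < x ->
  is_derive x 1 (fun t : R => t `^ a) (a * x `^ (a - 1)).
Proof.
move=> x0; have xi : x \in `]0, +oo[ by rewrite in_itv/= andbT.
split; first by apply: derivable_powR.
by rewrite -derive1E powR_derive1.
Qed.

(** The squared norm is a polynomial along each coordinate line, so in this form the kernel is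
    differentiated without passing through the square root. *)
Lemma rieszE (R : realType) n (b : R) (z : 'rV[R]_n) :
  riesz b z = (enorm z ^+ 2) `^ (- (b / 2)).
Proof.
rewrite /riesz -powR_mulrn ?enorm_ge0// -powRrM; congr (_ `^ _).
by rewrite mulrN mulrCA divff ?mulr1.
Qed.

Lemma is_derive_riesz (R : realType) n (b : R) (z : 'rV[R]_n) j : 0 < enorm z ->
  is_derive z (delta_mx ord0 j) (riesz b) (- b * riesz_grad b j z).
Proof.
move=> z0; apply: is_derive_of_line.
under eq_fun do rewrite rieszE enorm_shift_sqr.
have z2 : 0 < enorm z ^+ 2 by rewrite exprn_gt0.
pose phi (t : R) := enorm z ^+ 2 + (2 * t * z ord0 j + t ^+ 2).
have phi0 : phi 0 = enorm z ^+ 2 by rewrite /phi; ring.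
have dphi : is_derive (0 : R) 1 phi (2 * z ord0 j).
  by apply: is_derive_eq; rewrite /GRing.scale/=; ring.
have dp : is_derive (phi 0) 1 (fun t : R => t `^ (- (b / 2)))
    (- (b / 2) * (enorm z ^+ 2) `^ (- (b / 2) - 1)).
  by rewrite phi0; exact: is_derive_powR.
have := is_derive1_comp dp dphi.
set l := (X in is_derive _ _ _ X -> _) => h.
suff -> : - b * riesz_grad b j z = l by [].
have zne : enorm z != 0 by rewrite gt_eqF.
have -> : l = - b * z ord0 j * (enorm z ^+ 2) `^ (- (b / 2) - 1) by rewrite /l; field.
rewrite -powR_mulrn ?enorm_ge0// -powRrM.
have -> : 2 * (- (b / 2) - 1) = - (b + 1 + 1) by field.
rewrite powRN powRD; last by rewrite zne implybT.
by rewrite powRr1 ?enorm_ge0// invfM /riesz_grad; ring.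
Qed.

(** The Euclidean norm is 1-Lipschitz along the axis, so off the sphere a single branch of the
    maximum is active near [z]. *)
Lemma is_derive_truncated_riesz (R : realType) n (b r : R) (z : 'rV[R]_n) j :
  0 < r -> enorm z != r ->
  is_derive z (delta_mx ord0 j) (truncated_riesz b r)
    (if r <= enorm z then - b * riesz_grad b j z else 0).
Proof.
move=> r0 zr; apply: is_derive_of_line.
have near_line (d : R) : 0 < d -> \forall s \near (0 : R),
    `|enorm (z + s *: delta_mx ord0 j) - enorm z| < d.
  move=> d0; apply/nbhs_ballP; exists d => //= s; rewrite /ball/= sub0r normrN.
  exact: le_lt_trans (enorm_shift_dist _ _ _).
have [rz|rz] := leP r (enorm z).
  have {}rz : r < enorm z by rewrite lt_neqAle eq_sym zr.
  have dz : is_derive (0 : R) 1 (fun s => riesz b (z + s *: delta_mx ord0 j))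
      (- b * riesz_grad b j z).
    apply: is_derive_line; rewrite scale0r addr0.
    by apply: is_derive_riesz; exact: lt_trans rz.
  apply: near_eq_is_derive dz => //.
  have := near_line (enorm z - r); rewrite subr_gt0 => /(_ rz).
  apply: filterS => s; rewrite ltr_distl subKr => /andP[h _].
  by rewrite /truncated_riesz /riesz max_l// ltW.
apply: near_eq_is_derive (is_derive_cst (r `^ (- b)) _ _) => //.
have := near_line (r - enorm z); rewrite subr_gt0 => /(_ rz).
apply: filterS => s; rewrite ltr_distl => /andP[_]; rewrite subrKC => h.
by rewrite /truncated_riesz /= max_r// ltW.
Qed.

(** With [q = x / y] the left side is [x^-b (1 - q^b)], and [q^b >= q^N >= 1 - N (1 - q)] by
    Bernoulli's inequality. The bound is proportional to the kernel itself, so increments inherit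
    its decay. *)
Lemma powR_sub_le (R : realType) (N : nat) (b x y : R) : 0 <= b <= N%:R ->
  0 < x <= y -> x `^ (- b) - y `^ (- b) <= x `^ (- b) * (N%:R * ((y - x) / y)).
Proof.
move=> /andP[b0 bN] /andP[x0 xy].
have y0 : 0 < y by exact: lt_le_trans xy.
pose q := x / y.
have q01 : 0 < q <= 1 by rewrite divr_gt0//= ler_pdivrMr// mul1r.
have /andP[q0 q1] := q01.
have bern : 1 - N%:R * (1 - q) <= q ^+ N.
  elim: (N) => [|k IH]; first by rewrite mul0r subr0 expr0.
  rewrite exprS; apply: (@le_trans _ _ (q * (1 - k%:R * (1 - q)))); last first.
    by rewrite ler_wpM2l// ltW.
  have k0 : 0 <= k%:R :> R by [].
  rewrite -natr1 -subr_ge0.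
  have -> : q * (1 - k%:R * (1 - q)) - (1 - (k%:R + 1) * (1 - q)) =
    k%:R * (1 - q) ^+ 2 by ring.
  by rewrite mulr_ge0// sqr_ge0.
have qb : 1 - N%:R * (1 - q) <= q `^ b.
  apply: le_trans bern _; rewrite -powR_mulrn; last exact: ltW.
  exact: (ger_powR q01 bN).
have -> : y `^ (- b) = x `^ (- b) * q `^ b.
  rewrite /q powRM ?invr_ge0 ?(ltW x0) ?(ltW y0)// mulrA (powRN x) mulVf ?mul1r.
    by rewrite -powR_inv1 ?(ltW y0)// -powRrM mulN1r.
  by rewrite gt_eqF// powR_gt0.
rewrite -[X in X - _]mulr1 -mulrBr ler_wpM2l ?powR_ge0//.
have -> : (y - x) / y = 1 - q by rewrite /q mulrBl divff// gt_eqF.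
lra.
Qed.

Lemma powRN_le (R : realType) (b c x y : R) : 0 <= b -> 0 < c -> 0 < x ->
  0 < y -> x <= c * y -> y `^ (- b) <= c `^ b * x `^ (- b).
Proof.
move=> b0 c0 x0 y0 xy; rewrite !powRN ler_pdivlMr ?powR_gt0// mulrC.
rewrite ler_pdivrMr ?powR_gt0// -powRM; [|exact: ltW|exact: ltW].
by apply: ge0_ler_powR => //; rewrite ?nnegrE ?mulr_ge0// ltW.
Qed.

Lemma weight_shift (R : realType) n (b : R) (y h : 'rV[R]_n) (M : R) : 0 <= b ->
  `|h| <= M -> weight b (y + h) <= (1 + M) `^ b * weight b y.
Proof.
move=> b0 hM; have M0 : 0 <= M by exact: le_trans hM.
apply: powRN_le; rewrite ?ltr_pwDl//.
have : `|y| <= `|y + h| + `|h|.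
  by rewrite -{1}[y](addrK h) (le_trans (ler_normB _ _)).
have := normr_ge0 (y + h); nra.
Qed.

(** This rests on [1 + |z| <= (1 + 1/r) max(enorm z, r)]. *)
Lemma truncated_riesz_le (R : realType) n (b r : R) (z : 'rV[R]_n) :
  0 <= b -> 0 < r ->
  truncated_riesz b r z <= (1 + r^-1) `^ b * weight b z.
Proof.
move=> b0 r0; have M0 : 0 < Num.max (enorm z) r by rewrite lt_max r0 orbT.
apply: powRN_le; rewrite ?ltr_pwDl ?invr_ge0 ?(ltW r0)//.
rewrite mulrDl mul1r addrC lerD//; first by rewrite le_max norm_le_enorm.
by rewrite ler_pdivlMl// mulr1 le_max lexx orbT.
Qed.

Lemma truncated_riesz_shift (R : realType) n (N : nat) (b r : R) :
  0 <= b <= N%:R -> 0 < r ->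
  exists2 C : R, 0 <= C & forall (z : 'rV[R]_n) (j : 'I_n) (t : R), `|t| <= 1 ->
    `|truncated_riesz b r (z + t *: delta_mx ord0 j) - truncated_riesz b r z|
    <= C * weight b z * `|t|.
Proof.
move=> bN r0; have /andP[b0 _] := bN.
pose c := (1 + r^-1) `^ b; have c0 : 0 <= c by exact: powR_ge0.
have p2 : 0 <= (1 + 1) `^ b :> R by exact: powR_ge0.
(* [N / r] comes from [powR_sub_le], whose denominator is at least [r]. That lemma is based at the
   endpoint with the smaller [X]: if it is [z], the summand 1 suffices; if it is the shifted point,
   bringing its weight back to [z] costs [(1 + 1)^b]. *)
pose C := ((1 + 1) `^ b + 1) * c * (N%:R / r).
have Nr : 0 <= N%:R / r by rewrite divr_ge0// ltW.
exists C; first by do 2!apply: mulr_ge0 => //; exact: addr_ge0.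
move=> z j t t1.
pose X (y : 'rV[R]_n) := Num.max (enorm y) r.
have X0 y : 0 < X y by rewrite lt_max r0 orbT.
have rX y : r <= X y by rewrite le_max lexx orbT.
have key (y y' : 'rV[R]_n) : X y <= X y' -> `|X y' - X y| <= `|t| ->
    weight b y <= ((1 + 1) `^ b + 1) * weight b z ->
    `|truncated_riesz b r y - truncated_riesz b r y'| <= C * weight b z * `|t|.
  move=> yy' Xt wy.
  have yw := truncated_riesz_le y b0 r0.
  rewrite ger0_norm; last first.
    rewrite subr_ge0 /truncated_riesz !powRN lef_pV2 ?posrE ?powR_gt0 ?X0//.
    by apply: ge0_ler_powR => //; rewrite nnegrE ltW// X0.
  apply: le_trans (powR_sub_le bN _) _; first by rewrite X0.
  rewrite -/(truncated_riesz b r y).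
  rewrite (_ : C * _ * _ = (c * (((1 + 1) `^ b + 1) * weight b z)) * (N%:R * (`|t| / r))).
    apply: ler_pM => //.
    - exact: powR_ge0.
    - by rewrite mulr_ge0// divr_ge0 ?subr_ge0// ltW// X0.
    - by apply: le_trans yw _; rewrite ler_wpM2l.
    rewrite ler_wpM2l// ler_pM ?subr_ge0// ?invr_ge0 ?(ltW (X0 _))//.
      exact: le_trans (ler_norm _) Xt.
    by rewrite lef_pV2 ?posrE ?X0 ?rX.
  by rewrite /C; ring.
have w0 := weight_ge0 b z.
have Xd : `|X (z + t *: delta_mx ord0 j) - X z| <= `|t|.
  exact: le_trans (maxr_dist _ _ _) (enorm_shift_dist _ _ _).
case: (leP (X z) (X (z + t *: delta_mx ord0 j))) => h.
  rewrite distrC; apply: key => //.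
  by rewrite mulrDl mul1r lerDr mulr_ge0.
apply: key => //; first exact: ltW.
  by rewrite distrC.
apply: le_trans (weight_shift (M := 1) z b0 _) _.
  exact: le_trans (norm_scale_delta _ _) t1.
by rewrite mulrDl lerDl mul1r.
Qed.

(** Since [|z_j| <= enorm z], the kernel is at most the truncated power of order [b + 1]. For
    [b = n + s - 1] this order is [n + s], which is integrable at infinity. *)
Lemma riesz_grad_le (R : realType) n (b r : R) (z : 'rV[R]_n) j :
  0 <= b -> 0 < r -> r <= enorm z ->
  `|riesz_grad b j z| <= (1 + r^-1) `^ (b + 1) * weight (b + 1) z.
Proof.
move=> b0 r0 rz; have z0 : 0 < enorm z by exact: lt_le_trans rz.
apply: (@le_trans _ _ (truncated_riesz (b + 1) r z)); last first.
  by apply: truncated_riesz_le => //; rewrite addr_ge0.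
rewrite /truncated_riesz max_l// powRN /riesz_grad normrM.
rewrite [`|_^-1|]ger0_norm ?invr_ge0 ?powR_ge0// -[leRHS]mul1r ler_wpM2r//.
  by rewrite invr_ge0 powR_ge0.
by rewrite normrM normfV (gtr0_norm z0) ler_pdivrMr// mul1r coord_le_enorm.
Qed.

Lemma riesz_gradN (R : realType) n (b : R) (z : 'rV[R]_n) j :
  riesz_grad b j (- z) = - riesz_grad b j z.
Proof. by rewrite /riesz_grad enormN mxE !mulNr. Qed.

Lemma measurable_riesz (R : realType) n (b : R) :
  measurable_fun [set: 'rV[R]_n] (riesz b).
Proof.
apply: (@measurableT_comp _ _ _ _ _ _ (fun t : R => t `^ (- b)) _
  (@enorm R n)); [exact: measurable_powR|exact: measurable_enorm].
Qed.

Lemma measurable_truncated_riesz (R : realType) n (b r : R) :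
  measurable_fun [set: 'rV[R]_n] (truncated_riesz b r).
Proof.
apply: (@measurableT_comp _ _ _ _ _ _ (fun t : R => t `^ (- b)) _
  (fun z : 'rV[R]_n => Num.max (enorm z) r)); first exact: measurable_powR.
by apply: measurable_maxr => //; exact: measurable_enorm.
Qed.

Lemma measurable_riesz_grad (R : realType) n (b : R) j :
  measurable_fun [set: 'rV[R]_n] (riesz_grad b j).
Proof.
have mpow a : measurable_fun setT (fun z : 'rV[R]_n => enorm z `^ a).
  apply: (@measurableT_comp _ _ _ _ _ _ (fun t : R => t `^ a) _
    (@enorm R n)); [exact: measurable_powR|exact: measurable_enorm].
have -> : riesz_grad b j =
    fun z : 'rV[R]_n => z ord0 j * enorm z `^ (- 1) * enorm z `^ (- (b + 1)).
  by apply/funext => z; rewrite /riesz_grad powR_inv1 ?enorm_ge0// powRN.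
by do 2!apply: measurable_funM => //; exact: measurable_coord.
Qed.

(** * Riesz potentials *)

(** Dimension 0 is excluded because there the sphere of radius 0 is the whole space, of measure
    1. *)
Lemma ae_enorm_neq (R : realType) n (r : R) : (0 < n)%N ->
  {ae lebesgue_rV n, forall z : 'rV[R]_n, enorm z != r}.
Proof.
case: n => // n _; exists [set z | enorm z = r]; split.
- exact: measurable_sphere.
- exact: sphere_null.
- by move=> z /= /negP; rewrite negbK => /eqP.
Qed.

Lemma integrable_rV_shift (R : realType) n (a : 'rV[R]_n) (f : 'rV[R]_n -> R) :
  (lebesgue_rV n).-integrable setT (EFin \o f) ->
  (lebesgue_rV n).-integrable setT (fun z => (f (z + a))%:E).
Proof.
move=> /integrableP[/measurable_EFinP mf foo]; apply/integrableP; split.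
  by apply/measurable_EFinP; exact: measurable_rV_add.
rewrite (integral_rV_shift a (f := fun z => `|(f z)%:E|%E))//.
by apply: measurableT_comp => //; exact/measurable_EFinP.
Qed.

Lemma integrable_norm_le (R : realType) n (M : R) : 0 <= M ->
  (lebesgue_rV n).-integrable setT
    (EFin \o \1_[set z : 'rV[R]_n | `|z| <= M]).
Proof.
move=> M0; have mB := @measurable_norm_le R n M.
apply/integrableP; split; first exact/measurable_EFinP/measurable_indic.
under eq_integral => z _ do rewrite /= ger0_norm//.
rewrite integral_indic// setIT.
by apply: le_lt_trans (ltry ((2 * M) ^+ n)); rewrite -lebesgue_rV_norm_le.
Qed.

Lemma mean_value_line (R : realType) (V : normedModType R) (f df : V -> R) (y v : V)
    (h : R) :
  (forall y, is_derive y v f (df y)) -> 0 < h ->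
  exists2 s : R, 0 <= s <= h & f (y + h *: v) - f y = df (y + s *: v) * h.
Proof.
move=> dfP h0; pose g (s : R) := f (y + s *: v).
have dg (s : R) : is_derive s 1 g (df (y + s *: v)) by exact: is_derive_line.
have [|c] := @MVT R g (fun s => df (y + s *: v)) 0 h h0 (fun s _ => dg s).
  apply: continuous_subspaceT => s.
  apply/differentiable_continuous/derivable1_diffP.
  by have [] := dg s.
rewrite in_itv/= => /andP[c0 ch]; rewrite /g scale0r addr0 subr0 => E.
by exists c => //; rewrite !ltW.
Qed.

Lemma mean_value_bound (R : realType) (V : normedModType R) (w dw : V -> R) (e : V) (B : R) :
  (forall y, is_derive y e w (dw y)) -> (forall y, `|dw y| <= B) ->
  forall y t, `|w (y + t *: e) - w y| <= B * `|t|.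
Proof.
move=> dwP dwB; suff pos y t : 0 < t -> `|w (y + t *: e) - w y| <= B * `|t|.
  move=> y t; have [t0|t0|->] := ltgtP t 0; last first.
  - by rewrite scale0r addr0 subrr !normr0 mulr0.
  - exact: pos.
  - have := pos (y + t *: e) (- t); rewrite oppr_gt0 => /(_ t0).
    by rewrite -addrA -scalerDl subrr scale0r addr0 distrC normrN.
move=> t0; have [c _ ->] := mean_value_line y dwP t0.
by rewrite normrM ler_wpM2r.
Qed.

(** Height [B] and radius [M] are separate parameters because the estimates below are linear in [B]
    with a constant depending on [M]; small increments of [w] then give small potentials. *)
Definition bounded_support (R : realType) n (B M : R) (w : 'rV[R]_n -> R) : Prop :=
  [/\ measurable_fun setT w, forall y, `|w y| <= B &
      forall y, M < `|y| -> w y = 0].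

(** The convolution with the even kernel, written so that [x] enters only through [w]:
    differentiating in [x] never meets the singularity. *)
Definition riesz_potential (R : realType) n (b : R) (w : 'rV[R]_n -> R)
    (x : 'rV[R]_n) : R :=
  \int[lebesgue_rV n]_z (riesz b z * w (x + z)).

Lemma riesz_le_local (R : realType) n (b : R) (z : 'rV[R]_n) : 0 < b ->
  riesz b z <= (if `|z| <= 1 then `|z| `^ (- b) else 0) + 1.
Proof.
move=> b0; have [->|z0] := eqVneq z 0.
  rewrite /riesz (_ : enorm 0 = 0); last first.
    by rewrite /enorm big1 ?sqrtr0// => i _; rewrite mxE expr0n.
  by rewrite powR0 ?oppr_eq0 ?gt_eqF// addr_ge0//; case: ifP => // _; exact: powR_ge0.
have z1 : 0 < `|z| by rewrite normr_gt0.
have ez : 0 < enorm z by apply: lt_le_trans (norm_le_enorm z).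
case: ifPn => [_|]; rewrite /riesz !powRN.
  rewrite ler_wpDr// lef_pV2 ?posrE ?powR_gt0//.
  by apply: ge0_ler_powR; rewrite ?nnegrE ?(ltW b0) ?(ltW z1) ?(ltW ez) ?norm_le_enorm.
rewrite -ltNge add0r => zgt1; rewrite invf_le1 ?powR_gt0//.
have := @ler_powR _ (enorm z) _ 0 b (ltW b0); rewrite powRr0; apply.
exact: le_trans (ltW zgt1) (norm_le_enorm z).
Qed.

(** Extracts decay in [x]. On the support [|x| <= M + enorm z], so [1 + |x|] is at most [2 + M] when
    [enorm z <= 1] and at most [(2 + M) enorm z] otherwise; in the second case the power of
    [enorm z] cancels the kernel. *)
Lemma riesz_le_weight (R : realType) n (b M : R) (x z : 'rV[R]_n) : 0 < b ->
  0 <= M -> `|x + z| <= M ->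
  riesz b z <= (2 + M) `^ b * weight b x * (riesz b z + 1).
Proof.
move=> b0 M0 xzM; have ez := enorm_ge0 z.
rewrite mulrAC /weight powRN ler_pdivlMr ?powR_gt0 ?ltr_pwDl//.
have p0 := powR_ge0 (2 + M) b; have r0 : 0 <= riesz b z by exact: powR_ge0.
have xz : `|x| <= M + enorm z.
  rewrite -[x](addrK z) (le_trans (ler_normB _ _))// lerD//.
  exact: norm_le_enorm.
have [z1|z1] := leP (enorm z) 1.
  rewrite mulrC ler_pM ?powR_ge0// ?lerDl//.
  apply: ge0_ler_powR; rewrite ?nnegrE ?addr_ge0 ?(ltW b0)//; lra.
apply: (@le_trans _ _ (riesz b z * ((2 + M) `^ b * enorm z `^ b))).
  rewrite ler_wpM2l// -powRM ?addr_ge0//.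
  apply: ge0_ler_powR; rewrite ?nnegrE ?mulr_ge0 ?addr_ge0 ?(ltW b0)//; nra.
rewrite mulrCA ler_wpM2l// /riesz powRN mulVf ?lerDr ?invr_ge0 ?powR_ge0//.
by rewrite gt_eqF// powR_gt0// (lt_trans _ z1).
Qed.

(** The constant is chosen before [B], [w] and [x], so the same bound also controls the potentials
    of increments of [w]. *)
Lemma riesz_potential_bound (R : realType) n (b M : R) : 0 < b < n%:R -> 0 <= M ->
  exists2 C : R, 0 <= C & forall (B : R) (w : 'rV[R]_n -> R) x,
    bounded_support B M w ->
    (lebesgue_rV n).-integrable setT (fun z => (riesz b z * w (x + z))%:E) /\
    `|riesz_potential b w x| <= B * C * weight b x.
Proof.
move=> bn M0; have /andP[b0 _] := bn.
pose L (z : 'rV[R]_n) : R := if `|z| <= 1 then `|z| `^ (- b) else 0.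
have iL : (lebesgue_rV n).-integrable setT (EFin \o L) := local_powR_integrable bn.
have L0 z : 0 <= L z by rewrite /L; case: ifP => // _; exact: powR_ge0.
pose I (z : 'rV[R]_n) : R := \1_[set z : 'rV[R]_n | `|z| <= M] z.
have iI : (lebesgue_rV n).-integrable setT (EFin \o I) := integrable_norm_le n M0.
have mI : measurable_fun setT I by move/integrableP : iI => [/measurable_EFinP].
(* One unit of the factor 2 comes from [riesz_le_local], the other from the [+ 1] in
   [riesz_le_weight]. *)
pose J := \int[lebesgue_rV n]_z L z + 2 * \int[lebesgue_rV n]_z I z.
have J0 : 0 <= J.
  rewrite addr_ge0// ?mulr_ge0//; apply: Rintegral_ge0 => z _ //.
exists ((2 + M) `^ b * J); first by rewrite mulr_ge0// powR_ge0.
move=> B w x [mw wB wM].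
have B0 : 0 <= B by exact: le_trans (wB 0).
have iIx : (lebesgue_rV n).-integrable setT (EFin \o (fun z => I (z + x))).
  exact: integrable_rV_shift.
pose D z := B * (2 + M) `^ b * weight b x * (L z + 2 * I (z + x)).
have iLI : (lebesgue_rV n).-integrable setT (EFin \o (fun z => L z + 2 * I (z + x))).
  exact: (integrableD measurableT iL (integrableZl measurableT 2 iIx)).
have iD : (lebesgue_rV n).-integrable setT (EFin \o D).
  exact: (integrableZl measurableT (B * (2 + M) `^ b * weight b x) iLI).
have p0 := powR_ge0 (2 + M) b; have w0 := weight_ge0 b x.
have leD z : `|riesz b z * w (x + z)| <= D z.
  have r0 : 0 <= riesz b z by exact: powR_ge0.
  have [xz|xz] := leP `|x + z| M; last first.
    rewrite wM// mulr0 normr0 /D !mulr_ge0// addr_ge0// mulr_ge0//.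
  rewrite normrM (ger0_norm r0) /D mulrC -!mulrA ler_pM//.
  apply: le_trans (riesz_le_weight b0 M0 xz) _.
  rewrite -mulrA ler_wpM2l// ler_wpM2l//.
  rewrite /I indicE mem_set/= ?[z + x]addrC// mulr1.
  by have := riesz_le_local z b0; rewrite -/(L z); lra.
have mrw : measurable_fun setT (fun z => riesz b z * w (x + z)).
  apply: measurable_funM; first exact: measurable_riesz.
  by under eq_fun do rewrite addrC; exact: measurable_rV_add.
have irw : (lebesgue_rV n).-integrable setT (EFin \o (fun z => riesz b z * w (x + z))).
  exact: (le_integrable_R measurableT mrw (fun z _ => leD z) iD).
split=> //.
apply: le_trans (le_normr_Rintegral measurableT irw) _.
apply: (@le_trans _ _ (\int[lebesgue_rV n]_z D z)).
  apply: le_Rintegral => //.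
  exact: (integrable_norm irw).
have -> : \int[lebesgue_rV n]_z D z = B * (2 + M) `^ b * weight b x * J.
  rewrite /D RintegralZl// RintegralD//; last exact: (integrableZl measurableT 2 iIx).
  by rewrite RintegralZl// (Rintegral_rV_shift x).
by rewrite le_eqVlt; apply/orP; left; apply/eqP; ring.
Qed.

Lemma measurable_riesz_potential (R : realType) n (b : R) (w : 'rV[R]_n -> R) :
  measurable_fun setT w -> measurable_fun setT (riesz_potential b w).
Proof.
move=> mw.
pose h (p : 'rV[R]_n * 'rV[R]_n) : \bar R := (riesz b p.2 * w (p.1 + p.2))%:E.
have mh : measurable_fun setT h.
  apply/measurable_EFinP; apply: measurable_funM.
    by apply: (measurableT_comp (@measurable_riesz R n b)); exact: measurable_snd.
  apply: (measurableT_comp (g := fun p : 'rV[R]_n * 'rV[R]_n => p.1 + p.2)) => //.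
  apply/measurable_fun_coordP => i; under eq_fun do rewrite mxE.
  apply: measurable_funD.
    apply: (@measurableT_comp _ _ _ _ _ _ (fun y : 'rV[R]_n => y ord0 i) _ fst).
      exact: measurable_coord.
    exact: measurable_fst.
  apply: (@measurableT_comp _ _ _ _ _ _ (fun y : 'rV[R]_n => y ord0 i) _ snd).
    exact: measurable_coord.
  exact: measurable_snd.
have -> : riesz_potential b w = fine \o (fun x =>
    \int[lebesgue_rV n]_z (h^\+ (x, z)) - \int[lebesgue_rV n]_z (h^\- (x, z)))%E.
  apply/funext => x; rewrite /riesz_potential /Rintegral /= integralE.
  by congr (fine (_ - _)%E); apply: eq_integral => z _; rewrite ?funeposE ?funenegE.
apply: measurableT_comp; first exact: fine_measurable.
apply: emeasurable_funB.
  apply: (@measurable_fun_fubini_tonelli_F _ _ 'rV[R]_n 'rV[R]_n R (lebesgue_rV n)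
    (h^\+)%E) => //; first exact: measurable_funepos.
apply: (@measurable_fun_fubini_tonelli_F _ _ 'rV[R]_n 'rV[R]_n R (lebesgue_rV n)
    (h^\-)%E) => //; first exact: measurable_funeneg.
Qed.

Lemma is_derive_riesz_potential (R : realType) n (b B B' M : R)
    (w dw : 'rV[R]_n -> R) (j : 'I_n) (x : 'rV[R]_n) : 0 < b < n%:R -> 0 <= M ->
  bounded_support B M w -> bounded_support B' M dw ->
  (forall y : 'rV[R]_n, is_derive y (delta_mx ord0 j) w (dw y)) ->
  is_derive x (delta_mx ord0 j) (riesz_potential b w) (riesz_potential b dw x).
Proof.
move=> bn M0 hw hdw dwP; set e := delta_mx ord0 j.
have [C C0 TB] := riesz_potential_bound bn M0.
have M10 : 0 <= M + 1 by rewrite addr_ge0.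
have [C1 C10 TB1] := riesz_potential_bound bn M10.
have B'0 : 0 <= B' by have [_ h _] := hdw; exact: le_trans (h 0).
apply: is_derive_of_line.
pose f (s : R) (z : 'rV[R]_n) : R := riesz b z * w (x + s *: e + z).
have df (s : R) (z : 'rV[R]_n) : is_derive s 1 (f ^~ z) (riesz b z * dw (x + s *: e + z)).
  have dl : is_derive s 1 (fun s : R => w ((x + z) + s *: e)) (dw (x + s *: e + z)).
    by apply: is_derive_line; rewrite addrAC; exact: dwP.
  have -> : f ^~ z = riesz b z \*: (fun s : R => w ((x + z) + s *: e)).
    by apply/funext => s'; rewrite /f addrAC.
  exact: is_deriveZ.
have pf (s : R) (z : 'rV[R]_n) : partial1of2 f s z = riesz b z * dw (x + s *: e + z).
  by rewrite partial1of2E; have [_ ->] := df s z.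
(* A majorant valid for every [s] in []-1, 1[]: such a shift moves the support by less than one,
   whence the radius [M + 1]. *)
pose G (z : 'rV[R]_n) : R :=
  riesz b z * (B' * \1_[set y : 'rV[R]_n | `|y| <= M + 1] (x + z)).
have hG : bounded_support B' (M + 1)
    (fun y : 'rV[R]_n => B' * \1_[set y : 'rV[R]_n | `|y| <= M + 1] y).
  split.
  - apply: measurable_funM => //; apply: measurable_indic.
    exact: measurable_norm_le.
  - move=> y; rewrite indicE normrM (ger0_norm B'0).
    by case: (_ \in _); rewrite ?normr1 ?normr0 ?mulr1 ?mulr0.
  - by move=> y My; rewrite indicE memNset ?mulr0//= leNgt My.
have intf (s : R) : `]-1, 1[%classic s ->
    (lebesgue_rV n).-integrable setT (EFin \o f s).
  by move=> _; have [] := TB B w (x + s *: e) hw.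
have derf (s : R) (z : 'rV[R]_n) : `]-1, 1[%classic s -> setT z -> derivable (f ^~ z) s 1.
  by move=> _ _; have [] := df s z.
have G0 z : 0 <= G z by rewrite /G !mulr_ge0 ?powR_ge0.
have intG : (lebesgue_rV n).-integrable setT (EFin \o G) by have [] := TB1 B' _ x hG.
have Gub (s : R) (z : 'rV[R]_n) : `]-1, 1[%classic s -> setT z ->
    `|partial1of2 f s z| <= G z.
  move=> /= s1 _; rewrite pf /G normrM ger0_norm ?powR_ge0// ler_wpM2l ?powR_ge0//.
  have [_ dB dM] := hdw.
  have [xz|xz] := leP `|x + z| (M + 1).
    by rewrite indicE mem_set// mulr1.
  rewrite dM ?normr0 ?mulr_ge0//.
  move: s1; rewrite in_itv/= -ltr_norml => s1.
  have : `|x + z| <= `|x + s *: e + z| + `|s *: e|.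
    have -> : x + z = x + s *: e + z - s *: e by rewrite [RHS]addrAC addrK.
    exact: ler_normB.
  have := norm_scale_delta j s; rewrite -/e; lra.
have I0 : `]-1, 1[%classic (0 : R) by rewrite /= in_itv/=; apply/andP; split; lra.
have dU := derivable_under_integral measurableT I0 intf derf G0 intG Gub.
have dE := differentiation_under_integral measurableT I0 intf derf G0 intG Gub.
have -> : riesz_potential b dw x = \int[lebesgue_rV n]_z partial1of2 f 0 z.
  by apply: eq_Rintegral => z _; rewrite pf scale0r addr0.
split; first exact: dU.
by rewrite -derive1E; exact: dE.
Qed.

(** Makes an increment of [w] an admissible density for [riesz_potential_bound], with height linear
    in [|t|] by the mean value theorem. *)
Lemma bounded_support_shift (R : realType) n (B M : R) (e : 'rV[R]_n)
    (w dw : 'rV[R]_n -> R) (t : R) :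
  bounded_support B M dw -> (exists B0, bounded_support B0 M w) ->
  (forall y : 'rV[R]_n, is_derive y e w (dw y)) -> `|e| <= 1 -> `|t| <= 1 ->
  bounded_support (B * `|t|) (M + 1) (fun y => w (y + t *: e) - w y).
Proof.
move=> [mdw dwB dwM] [B0 [mw wB wM]] dwP e1 t1.
have te : `|t *: e| <= 1 by rewrite normrZ mulr_ile1.
split.
- by apply: measurable_funB => //; exact: measurable_rV_add.
- by move=> y; exact: (mean_value_bound dwP dwB).
move=> y yM; rewrite !wM ?subrr//; first lra.
have : `|y| <= `|y + t *: e| + `|t *: e|.
  by rewrite -{1}[y](addrK (t *: e)) (le_trans (ler_normB _ _)).
lra.
Qed.

(** The increment of the potential is the potential of the increment. *)
Lemma riesz_potential_shift_bound (R : realType) n (b B B' M : R)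
    (w dw : 'rV[R]_n -> R) (j : 'I_n) : 0 < b < n%:R -> 0 <= M ->
  bounded_support B M w -> bounded_support B' M dw ->
  (forall y : 'rV[R]_n, is_derive y (delta_mx ord0 j) w (dw y)) ->
  exists2 C : R, 0 <= C & forall (x : 'rV[R]_n) (t : R), `|t| <= 1 ->
    `|riesz_potential b w (x + t *: delta_mx ord0 j) - riesz_potential b w x|
      <= C * weight b x * `|t|.
Proof.
move=> bn M0 hw hdw dwP; set e := delta_mx ord0 j.
have M10 : 0 <= M + 1 by rewrite addr_ge0.
have [C C0 TB] := riesz_potential_bound bn M0.
have [C1 C10 TB1] := riesz_potential_bound bn M10.
have B'0 : 0 <= B' by have [_ h _] := hdw; exact: le_trans (h 0).
exists (B' * C1); first exact: mulr_ge0.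
move=> x t t1.
have e1 : `|e| <= 1 by exact: norm_delta_le1.
have hD := bounded_support_shift hdw (ex_intro _ B hw) dwP e1 t1.
have [_] := TB1 _ _ x hD.
have -> : riesz_potential b (fun y => w (y + t *: e) - w y) x =
    riesz_potential b w (x + t *: e) - riesz_potential b w x.
  have [i1 _] := TB B w (x + t *: e) hw; have [i2 _] := TB B w x hw.
  rewrite /riesz_potential -RintegralB//; apply: eq_Rintegral => z _.
  by rewrite mulrBr addrAC.
by move=> /le_trans; apply; rewrite le_eqVlt; apply/orP; left; apply/eqP; ring.
Qed.

(** For each [z] off the origin the two kernels agree as soon as [r] is below [enorm z]; domination
    by the untruncated integrand gives the limit. *)
Lemma truncated_riesz_potential_cvg (R : realType) n (b B M : R)
    (w : 'rV[R]_n -> R) (x : 'rV[R]_n) : 0 < b < n%:R -> 0 <= M ->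
  bounded_support B M w ->
  \int[lebesgue_rV n]_z (truncated_riesz b r z * w (x + z)) @[r --> 0^'+]
    --> riesz_potential b w x.
Proof.
move=> bn M0 hw; have [mw _ _] := hw; have /andP[b0 bn'] := bn.
have n0 : (0 < n)%N by rewrite -(ltr_nat R) (lt_trans b0).
have [C C0 TB] := riesz_potential_bound bn M0.
have [intw _] := TB B w x hw.
have mwx : measurable_fun setT (fun z => w (x + z)).
  by under eq_fun do rewrite addrC; exact: measurable_rV_add.
apply/cvg_at_rightP => r [r0 rcvg].
have [|||||_ //] := @dominated_convergence_Rintegral _ _ R (lebesgue_rV n)
    (fun k z => truncated_riesz b (r k) z * w (x + z))
    (fun z => riesz b z * w (x + z)) (fun z => `|riesz b z * w (x + z)|).
- move=> k; apply: measurable_funM => //; exact: measurable_truncated_riesz.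
- apply: measurable_funM => //; exact: measurable_riesz.
- apply: filterS (ae_enorm_neq 0 n0) => z z0.
  have zp : 0 < enorm z by rewrite lt_neqAle eq_sym z0 enorm_ge0.
  apply: cvg_near_cst.
  have /cvgr_dist_lt := rcvg; move=> /(_ (enorm z) zp).
  apply: filterS => k; rewrite sub0r normrN gtr0_norm// => rk.
  by rewrite /truncated_riesz max_l// ltW.
- exact: (integrable_norm intw).
(* The domination can fail at the origin, where [riesz] has the default value 0 while the truncated
   kernel is positive; hence almost everywhere only. *)
- apply: filterS (ae_enorm_neq 0 n0) => z z0 k.
  have zp : 0 < enorm z by rewrite lt_neqAle eq_sym z0 enorm_ge0.
  rewrite !normrM ler_wpM2r// !ger0_norm ?powR_ge0//.
  rewrite /truncated_riesz /riesz !powRN lef_pV2 ?posrE ?powR_gt0 ?lt_max ?zp//.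
  by apply: ge0_ler_powR; rewrite ?nnegrE ?le_max ?lexx ?(ltW b0) ?(ltW zp).
Qed.

(** * Smooth functions with compact support *)

(** The mean value theorem twice: in direction [a] for the increment [phi] of [f] along [b], then in
    direction [b] for [fa]. *)
Lemma second_difference (R : realType) (V : normedModType R) (f fa fab : V -> R)
    (y a b : V) (h : R) :
  (forall y, is_derive y a f (fa y)) -> (forall y, is_derive y b fa (fab y)) ->
  0 < h -> exists s t : R, [/\ 0 <= s <= h, 0 <= t <= h &
    f (y + h *: a + h *: b) - f (y + h *: a) - f (y + h *: b) + f y =
    fab (y + s *: a + t *: b) * h ^+ 2].
Proof.
move=> dfa dfab h0.
pose phi z := f (z + h *: b) - f z.
have dphi z : is_derive z a phi (fa (z + h *: b) - fa z).
  apply: is_deriveB; apply: is_derive_of_line.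
  have -> : (fun s : R => f (z + s *: a + h *: b)) =
      (fun s : R => f ((z + h *: b) + s *: a)).
    by apply/funext => s; rewrite addrAC.
  by apply: is_derive_line; rewrite scale0r addr0; exact: dfa.
have [s sh E1] := mean_value_line y dphi h0.
have [t th E2] := mean_value_line (y + s *: a) dfab h0.
exists s, t; split => //.
by rewrite expr2 mulrA -E2 -E1 /phi; ring.
Qed.

(** [smooth] speaks only of iterated partial derivatives along the basis vectors, so the symmetry of
    second derivatives has to be derived from their continuity. *)
Lemma schwarz (R : realType) (V : normedModType R) (f fa fb fab fba : V -> R)
    (y a b : V) :
  (forall y, is_derive y a f (fa y)) -> (forall y, is_derive y b f (fb y)) ->
  (forall y, is_derive y b fa (fab y)) -> (forall y, is_derive y a fb (fba y)) ->
  continuous fab -> continuous fba -> fab y = fba y.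
Proof.
move=> dfa dfb dfab dfba cab cba.
apply/eqP; rewrite -subr_eq0 -normr_le0; apply/ler_addgt0Pl => e e0.
rewrite addr0.
have e2 : 0 < e / 2 by rewrite divr_gt0.
have /cvgr_dist_lt/(_ _ e2)/nbhs_ballP[d1 /= d10 H1] := cab y.
have /cvgr_dist_lt/(_ _ e2)/nbhs_ballP[d2 /= d20 H2] := cba y.
pose N := `|a| + `|b| + 1.
have N0 : 0 < N by rewrite ltr_wpDl// addr_ge0.
(* Chosen so that [h (|a| + |b|)] stays below both radii of continuity; the [+ 1] in [N] keeps the
   denominator positive when [a] and [b] vanish. *)
pose h := Num.min d1 d2 / (2 * N).
have m0 : 0 < Num.min d1 d2 by rewrite lt_min d10.
have h0 : 0 < h by rewrite divr_gt0// mulr_gt0.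
have close (s t : R) : 0 <= s <= h -> 0 <= t <= h ->
    `|y - (y + s *: a + t *: b)| < Num.min d1 d2.
  move=> /andP[s0 sh] /andP[t0 th].
  rewrite -addrA opprD addNKr normrN (le_lt_trans (ler_normD _ _))//.
  rewrite !normrZ !ger0_norm//.
  apply: (@le_lt_trans _ _ (h * `|a| + h * `|b|)).
    by rewrite lerD// ler_wpM2r.
  have hN : h * N = Num.min d1 d2 / 2 by rewrite /h; field; rewrite gt_eqF.
  by move: hN; rewrite /N; nra.
(* The same second difference is [h ^+ 2] times a nearby value of [fab] and
   [h ^+ 2] times a nearby value of [fba]. *)
have [s [t [sh th E]]] := second_difference y dfa dfab h0.
have [t' [s' [th' sh' E']]] := second_difference y dfb dfba h0.
have EE : fab (y + s *: a + t *: b) = fba (y + t' *: b + s' *: a).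
  have h2 : h ^+ 2 != 0 by rewrite expf_neq0// gt_eqF.
  apply: (mulIf h2); rewrite -E -E' (addrAC y (h *: b)).
  by rewrite -!addrA; congr (_ + _); rewrite !addrA; congr (_ + _); rewrite addrC.
have h1 : `|fab y - fab (y + s *: a + t *: b)| < e / 2.
  apply: H1; rewrite -ball_normE /ball_/=.
  by apply: lt_le_trans (close _ _ sh th) _; rewrite ge_min lexx.
have h2 : `|fba y - fba (y + t' *: b + s' *: a)| < e / 2.
  apply: H2; rewrite -ball_normE /ball_/= (addrAC y).
  by apply: lt_le_trans (close _ _ sh' th') _; rewrite ge_min lexx orbT.
rewrite -(subrKA (fab (y + s *: a + t *: b))) [X in _ + (X - _)]EE.
rewrite (le_trans (ler_normD _ _))// (splitr e) lerD// ?ltW//.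
by rewrite distrC.
Qed.

Lemma bounded_support_continuous (R : realType) n (f : 'rV[R]_n -> R) (M : R) :
  continuous f -> (forall y, M < `|y| -> f y = 0) ->
  exists B, bounded_support B M f.
Proof.
move=> cf fM.
have [B fB] : exists B, forall y, `|y| <= M -> `|f y| <= B.
  pose A := [set y : 'rV[R]_n | `|y| <= M].
  have cA : compact A.
    apply: bounded_closed_compact.
      exists M; split; first exact: num_real.
      by move=> x Mx y /= yM; rewrite (le_trans yM)// ltW.
    rewrite /A; apply: (@preimage_closed _ _ (fun y : 'rV[R]_n => `|y|) [set x | x <= M]).
      by move=> y _; exact: norm_continuous.
    exact: closed_le.
  have : bounded_set (f @` A).
    apply: compact_bounded; apply: continuous_compact => //.
    exact: continuous_subspaceT.
  move=> [B [_ HB]]; exists (B + 1) => y yM.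
  by apply: (HB (B + 1)); [rewrite ltrDl|exists y].
exists (Num.max B 0); split => //; first exact: continuous_measurable_rV.
move=> y; rewrite le_max; case: (leP `|y| M) => yM; first by rewrite fB.
by rewrite fM// normr0 lexx orbT.
Qed.

(** The strict inequality defines an open set, so [f] vanishes in a neighbourhood of [y]. *)
Lemma partial_eq0 (R : realType) n (V : normedModType R) (f : 'rV[R]_n -> V) (M : R) i :
  (forall y, M < `|y| -> f y = 0) -> forall y, M < `|y| -> partial i f y = 0.
Proof.
move=> fM y yM; rewrite /partial -[RHS](derive_cst (0 : V) y (delta_mx ord0 i)).
apply: near_eq_derive.
near=> z; apply: fM.
by near: z; apply: (@cvgr_gt _ _ _ _ (fun z : 'rV[R]_n => `|z|)); [exact: norm_continuous|].
Unshelve. all: by end_near. Qed.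

Lemma iter_partial_eq0 (R : realType) n (V : normedModType R) (f : 'rV[R]_n -> V) (M : R) l :
  (forall y, M < `|y| -> f y = 0) ->
  forall y, M < `|y| -> iter_partial l f y = 0.
Proof. by move=> fM; elim: l => //= i l IH; exact: partial_eq0. Qed.

Lemma compactly_supported_eq0 (R : realType) n (V : normedModType R) (f : 'rV[R]_n -> V) :
  compactly_supported f -> exists2 M : R, 0 <= M & forall y, M < `|y| -> f y = 0.
Proof.
move=> /compact_bounded[M [_ HM]]; exists (Num.max (M + 1) 0).
  by rewrite le_max lexx orbT.
move=> y; rewrite gt_max => /andP[My _]; apply/eqP/negPn/negP => fy.
have cy : closure [set x | f x != 0] y by exact: subset_closure.
have := HM (M + 1); rewrite ltrDl => /(_ ltr01 y cy) /=.
by rewrite leNgt My.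
Qed.

Lemma smooth_coord_is_derive (R : realType) n m (u : 'rV[R]_n -> 'rV[R]_m) l (i : 'I_m) j y :
  smooth u -> is_derive y (delta_mx ord0 j) (fun z => iter_partial l u z ord0 i)
    (iter_partial (j :: l) u y ord0 i).
Proof.
move=> /(_ l)[_ /(_ j y) du]; split; first by move/derivable_mxP : du.
by rewrite /= /partial derive_mx// mxE.
Qed.

Lemma smooth_coord_continuous (R : realType) n m (u : 'rV[R]_n -> 'rV[R]_m) l (i : 'I_m) :
  smooth u -> continuous (fun z => iter_partial l u z ord0 i).
Proof.
move=> /(_ l)[cu _] y; apply: (@continuous_comp _ _ _ (iter_partial l u)
  (fun v : 'rV[R]_m => v ord0 i) y).
  exact: cu.
exact: coord_continuous.
Qed.

Lemma smooth_partialC (R : realType) n m (u : 'rV[R]_n -> 'rV[R]_m) (i : 'I_m) j l y :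
  smooth u -> iter_partial [:: j; l] u y ord0 i = iter_partial [:: l; j] u y ord0 i.
Proof.
move=> su.
apply: (@schwarz _ _ (fun z => iter_partial [::] u z ord0 i)
  (fun z => iter_partial [:: l] u z ord0 i) (fun z => iter_partial [:: j] u z ord0 i)
  (fun z => iter_partial [:: j; l] u z ord0 i) (fun z => iter_partial [:: l; j] u z ord0 i)
  y (delta_mx ord0 l) (delta_mx ord0 j)) => [z|z|z|z||];
  by [exact: smooth_coord_is_derive|exact: smooth_coord_continuous].
Qed.

Lemma smooth_bounded_support (R : realType) n m (u : 'rV[R]_n -> 'rV[R]_m) :
  smooth u -> compactly_supported u -> exists2 M : R, 0 <= M &
    forall l i, exists B, bounded_support B M (fun z => iter_partial l u z ord0 i).
Proof.
move=> su /compactly_supported_eq0[M M0 uM]; exists M => // l i.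
apply: bounded_support_continuous; first exact: smooth_coord_continuous.
by move=> y yM; rewrite (iter_partial_eq0 l uM)// mxE.
Qed.

(** * Principal values *)

(** Extending by zero turns integrals outside a ball into integrals over the whole space. For
    [r > 0] and [b != 0] this is, off the sphere, [- b^-1] times the [j]-th derivative of
    [truncated_riesz b r]. *)
Definition truncated_riesz_grad (R : realType) n (b r : R) (j : 'I_n)
    (z : 'rV[R]_n) : R :=
  if r <= enorm z then riesz_grad b j z else 0.

Lemma measurable_truncated_riesz_grad (R : realType) n (b r : R) j :
  measurable_fun [set: 'rV[R]_n] (truncated_riesz_grad b r j).
Proof.
apply: measurable_fun_ifT => //; last exact: measurable_riesz_grad.
by apply: measurable_fun_ler => //; exact: measurable_enorm.
Qed.

Lemma truncated_riesz_grad_le (R : realType) n (b r : R) (z : 'rV[R]_n) j :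
  0 <= b -> 0 < r ->
  `|truncated_riesz_grad b r j z| <= (1 + r^-1) `^ (b + 1) * weight (b + 1) z.
Proof.
move=> b0 r0; rewrite /truncated_riesz_grad; case: ifPn => rz.
  exact: riesz_grad_le.
by rewrite normr0 mulr_ge0 ?powR_ge0.
Qed.

Lemma truncated_riesz_grad_integrable (R : realType) n (b r : R) j
    (f : 'rV[R]_n -> R) (B : R) :
  n%:R < b + 1 -> 0 <= b -> 0 < r ->
  measurable_fun setT f -> (forall z, `|f z| <= B) ->
  (lebesgue_rV n).-integrable setT
    (fun z => (f z * truncated_riesz_grad b r j z)%:E).
Proof.
move=> nb b0 r0 mf fB; have B0 : 0 <= B by exact: le_trans (fB 0).
apply: (@le_integrable_R _ _ _ _ setT _
  (fun z => B * (1 + r^-1) `^ (b + 1) * weight (b + 1) z)) => //.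
- by apply: measurable_funM => //; exact: measurable_truncated_riesz_grad.
- move=> z _; rewrite normrM -mulrA ler_pM//.
  exact: truncated_riesz_grad_le.
exact: (integrableZl measurableT (B * (1 + r^-1) `^ (b + 1)) (weight_integrable nb)).
Qed.

Lemma truncated_riesz_grad_integrable1 (R : realType) n (b r : R) (j : 'I_n) :
  n%:R < b + 1 -> 0 <= b -> 0 < r ->
  (lebesgue_rV n).-integrable setT (EFin \o truncated_riesz_grad b r j).
Proof.
move=> nb b0 r0.
have := @truncated_riesz_grad_integrable R n b r j (cst 1) 1 nb b0 r0.
move=> /(_ (measurable_cst _)) iG.
apply: eq_integrable (iG _) => // [z _|z]; first by rewrite /= mul1r.
by rewrite normr1.
Qed.

Lemma truncated_riesz_gradN (R : realType) n (b r : R) (z : 'rV[R]_n) j :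
  truncated_riesz_grad b r j (- z) = - truncated_riesz_grad b r j z.
Proof.
rewrite /truncated_riesz_grad enormN riesz_gradN.
by case: ifP => // _; rewrite oppr0.
Qed.

Lemma Rintegral_rV_opp (R : realType) n (f : 'rV[R]_n -> R) :
  measurable_fun [set: 'rV[R]_n] f ->
  \int[lebesgue_rV n]_x f (- x) = \int[lebesgue_rV n]_x f x.
Proof.
move=> mf; rewrite /Rintegral; congr fine.
by rewrite -[RHS]integral_rV_opp//; exact/measurable_EFinP.
Qed.

Lemma integral_truncated_riesz_grad (R : realType) n (b r : R) (j : 'I_n) :
  n%:R < b + 1 -> 0 <= b -> 0 < r ->
  \int[lebesgue_rV n]_z truncated_riesz_grad b r j z = 0.
Proof.
move=> nb b0 r0.
have mG := @measurable_truncated_riesz_grad R n b r j.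
have iG := @truncated_riesz_grad_integrable1 R n b r j nb b0 r0.
have E := Rintegral_rV_opp mG.
have E' : \int[lebesgue_rV n]_z truncated_riesz_grad b r j (- z) =
    (- 1) * \int[lebesgue_rV n]_z truncated_riesz_grad b r j z.
  rewrite -(RintegralZl (-1) measurableT iG).
  by apply: eq_Rintegral => z _; rewrite truncated_riesz_gradN mulN1r.
set I := LHS; suff NI : - I = I by apply/eqP; rewrite -eqNr; apply/eqP.
by rewrite /I -[RHS]E E' mulN1r.
Qed.

(** The sign of the integration by parts cancels the one in the derivative of the kernel. A single
    majorant [H] controls [f] and its increments, and the kernel contributes [weight b]. *)
Lemma integral_truncated_riesz_by_parts (R : realType) n (b r : R) (j : 'I_n)
    (f df H : 'rV[R]_n -> R) :
  0 < b <= n%:R -> 0 < r ->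
  measurable_fun setT f -> measurable_fun setT df ->
  (forall y : 'rV[R]_n, is_derive y (delta_mx ord0 j) f (df y)) ->
  (forall y, `|f y| <= H y) ->
  (forall (y : 'rV[R]_n) (t : R), `|t| <= 1 ->
     `|f (y + t *: delta_mx ord0 j) - f y| <= H y * `|t|) ->
  (lebesgue_rV n).-integrable setT (fun y => (H y * weight b y)%:E) ->
  [/\ (lebesgue_rV n).-integrable setT
        (fun z => (f z * truncated_riesz_grad b r j z)%:E),
      (lebesgue_rV n).-integrable setT
        (fun z => (df z * truncated_riesz b r z)%:E) &
      \int[lebesgue_rV n]_z (f z * truncated_riesz_grad b r j z) =
      b^-1 * \int[lebesgue_rV n]_z (df z * truncated_riesz b r z)].
Proof.
move=> /andP[b0 bn] r0 mf mdf dfP fH dfH iH.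
have n0 : (0 < n)%N by rewrite -(ltr_nat R) (lt_le_trans b0).
have bN : 0 <= b <= n%:R by rewrite (ltW b0).
have [C C0 KC] := @truncated_riesz_shift R n n b r bN r0.
(* One constant for the increments of the kernel ([C]) and for its values. *)
pose C' := Num.max C ((1 + r^-1) `^ b).
have bne : b != 0 by rewrite gt_eqF.
have [||||||||||i1 i2 E] := @integration_by_parts_rV R n (delta_mx ord0 j) f df
  (truncated_riesz b r) (fun z => - b * truncated_riesz_grad b r j z)
  H (fun z => C' * weight b z).
- exact: mf.
- exact: mdf.
- exact: measurable_truncated_riesz.
- by apply: measurable_funM => //; exact: measurable_truncated_riesz_grad.
- apply: filterS (ae_enorm_neq r n0) => z zr.
  have := is_derive_truncated_riesz b j r0 zr.
  by rewrite /truncated_riesz_grad; case: ifP => // _; rewrite mulr0.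
- exact: fH.
- move=> z; rewrite ger0_norm ?powR_ge0//.
  apply: le_trans (truncated_riesz_le z (ltW b0) r0) _.
  by rewrite ler_wpM2r ?weight_ge0// le_max lexx orbT.
- exact: dfH.
- move=> z t t1; apply: le_trans (KC z j t t1) _.
  by rewrite !ler_wpM2r ?weight_ge0// le_max lexx.
- have -> : (fun y : 'rV[R]_n => (H y * (C' * weight b y))%:E) =
      (fun y => (C' * (H y * weight b y))%:E).
    by apply/funext => y; congr EFin; rewrite mulrCA.
  exact: (integrableZl measurableT C' iH).
have i1' : (lebesgue_rV n).-integrable setT
    (EFin \o (fun z => f z * truncated_riesz_grad b r j z)).
  have := integrableZl measurableT (- b^-1) i1.
  apply: eq_integrable => // z _ /=; rewrite -EFinM; congr EFin.
  by rewrite mulrCA [- b^-1 * _]mulrA mulrNN mulVf// mul1r.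
split => //.
have -> : \int[lebesgue_rV n]_z (df z * truncated_riesz b r z) =
    b * \int[lebesgue_rV n]_z (f z * truncated_riesz_grad b r j z).
  rewrite -[LHS]opprK -E -mulN1r -RintegralZl// -RintegralZl//.
  by apply: eq_Rintegral => z _; ring.
by rewrite mulKf.
Qed.

Lemma setC_eballE (R : realType) n (x y : 'rV[R]_n) (r : R) :
  (y \in ~` eball x r) = (r <= enorm (y - x)).
Proof.
rewrite in_setC; apply/negP/idP => [h|h].
  by rewrite leNgt; apply/negP => yx; apply: h; rewrite inE.
by rewrite inE /eball/= => yx; move: h; rewrite leNgt yx.
Qed.

Lemma measurable_setC_eball (R : realType) n (x : 'rV[R]_n) (r : R) :
  measurable (~` eball x r).
Proof.
have := measurable_rV_add (- x) (@measurable_enorm R n).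
move=> /(_ measurableT `[r, +oo[%classic (measurable_itv _)); rewrite setTI.
set A := (X in measurable X); suff -> : ~` eball x r = A by [].
apply/seteqP; split => y.
  by move=> /mem_set; rewrite setC_eballE /A /= in_itv/= andbT.
by rewrite /A /= in_itv/= andbT -setC_eballE inE.
Qed.

Section outside_ball.
Context {R : realType} {n : nat}.
Variables (f : 'rV[R]_n -> R) (x : 'rV[R]_n) (r : R).
Hypothesis mf : measurable_fun setT f.

Let g (z : 'rV[R]_n) : R := if r <= enorm z then f (x + z) else 0.

Let mg : measurable_fun setT g.
Proof.
apply: measurable_fun_ifT => //.
  by apply: measurable_fun_ler => //; exact: measurable_enorm.
by under eq_fun do rewrite addrC; exact: measurable_rV_add.
Qed.

Let restrictE : f \_ (~` eball x r) = fun y => g (y + - x).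
Proof.
apply/funext => y; rewrite /patch setC_eballE /g; case: ifP => // _.
by rewrite addrC subrK.
Qed.

Lemma truncated_integralE :
  truncated_integral x f r =
  \int[lebesgue_rV n]_z (if r <= enorm z then f (x + z) else 0).
Proof.
rewrite /truncated_integral Rintegral_mkcond restrictE.
exact: (Rintegral_rV_shift (- x) mg).
Qed.

Lemma integrable_outside_ball :
  (lebesgue_rV n).-integrable setT
    (fun z => (if r <= enorm z then f (x + z) else 0)%:E) ->
  (lebesgue_rV n).-integrable (~` eball x r) (fun y => (f y)%:E).
Proof.
move=> ig; apply/integrable_mkcond; first exact: measurable_setC_eball.
have := integrable_rV_shift (- x) ig.
apply: eq_integrable => // y _ /=; rewrite /patch setC_eballE.
by case: ifP => // _; rewrite addrC subrK.
Qed.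

End outside_ball.

Lemma has_pv_cst (R : realType) n (f : 'rV[R]_n -> R) (x : 'rV[R]_n) (l : R) :
  measurable_fun setT f ->
  (forall r, 0 < r -> (lebesgue_rV n).-integrable setT
    (fun z => (if r <= enorm z then f (x + z) else 0)%:E)) ->
  \int[lebesgue_rV n]_z (if r <= enorm z then f (x + z) else 0) @[r --> 0^'+] --> l ->
  has_pv x f /\ pv x f = l.
Proof.
move=> mf fi fl.
have fl' : truncated_integral x f r @[r --> 0^'+] --> l.
  by under eq_fun do rewrite truncated_integralE//.
split; last exact: cvg_lim.
split; last by apply/cvg_ex; exists l.
by move=> r r0; apply: integrable_outside_ball => //; exact: fi.
Qed.

Lemma is_derive_translate (R : realType) (V : normedModType R) (f : V -> R) (x y v : V) l :
  is_derive (x + y) v f l -> is_derive y v (fun z => f (x + z)) l.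
Proof.
move=> df; apply: is_derive_of_line.
have -> : (fun s : R => f (x + (y + s *: v))) = (fun s : R => f ((x + y) + s *: v)).
  by apply/funext => s; rewrite addrA.
by apply: is_derive_line; rewrite scale0r addr0.
Qed.

(** Both differences are reversed, so the signs cancel; the exponent [n + s] is [b + 1] for
    [b = n + s - 1]. *)
Lemma fgrad_kernelE (R : realType) n (s : R) (u : 'rV[R]_n -> 'rV[R]_n) x i j y :
  fgrad_kernel s u x i j y =
  (u y ord0 i - u x ord0 i) * riesz_grad (n%:R + s - 1) j (y + - x).
Proof.
rewrite /fgrad_kernel -(opprB x y) riesz_gradN /riesz_grad subrK.
by rewrite mxE [(- u y) _ _]mxE; ring.
Qed.

Lemma riesz_order_bounds (R : realType) (n : nat) (s : R) :
  (0 < n)%N -> 0 < s < 1 -> 0 < n%:R + s - 1 < n%:R.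
Proof.
rewrite -(ler1n R) => n1 /andP[s0 s1]; apply/andP; split; lra.
Qed.

Lemma fgrad_pv (R : realType) n (s : R) (u : 'rV[R]_n -> 'rV[R]_n) x i j :
  (0 < n)%N -> 0 < s < 1 -> smooth u -> compactly_supported u ->
  has_pv x (fgrad_kernel s u x i j) /\
  pv x (fgrad_kernel s u x i j) = (n%:R + s - 1)^-1 *
    riesz_potential (n%:R + s - 1) (fun z => partial j u z ord0 i) x.
Proof.
move=> n0 s01 su cu; set b := n%:R + s - 1.
have bb : 0 < b < n%:R by exact: riesz_order_bounds.
have /andP[b0 bn] := bb.
have nb : n%:R < b + 1 by move: s01 => /andP[s0 _]; rewrite /b; lra.
have [M M0 bs] := smooth_bounded_support su cu.
have [B hw] := bs [::] i; have [B' hdw] := bs [:: j] i.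
pose w (z : 'rV[R]_n) := u z ord0 i.
pose dw (z : 'rV[R]_n) := partial j u z ord0 i.
have dwP (y : 'rV[R]_n) : is_derive y (delta_mx ord0 j) w (dw y).
  exact: (@smooth_coord_is_derive R n n u [::] i j y su).
have [mw wB wM] : bounded_support B M w := hw.
have [mdw dwB dwM] : bounded_support B' M dw := hdw.
have M10 : 0 <= M + 1 by rewrite addr_ge0.
have B0 : 0 <= B by exact: le_trans (wB 0).
have B'0 : 0 <= B' by exact: le_trans (dwB 0).
have madd (f : 'rV[R]_n -> R) : measurable_fun setT f ->
    measurable_fun setT (fun z => f (x + z)).
  by move=> mf; under eq_fun do rewrite addrC; exact: measurable_rV_add.
have kE r z : (if r <= enorm z then fgrad_kernel s u x i j (x + z) else 0) =
    (w (x + z) - w x) * truncated_riesz_grad b r j z.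
  rewrite /truncated_riesz_grad; case: ifP => _; last by rewrite mulr0.
  by rewrite fgrad_kernelE [x + z]addrC addrK.
pose I (z : 'rV[R]_n) : R := \1_[set z : 'rV[R]_n | `|z| <= M + 1] z.
(* [B] bounds the values of [w] and [B'] its difference quotients; both vanish outside the cube
   enlarged by one unit. *)
pose H (z : 'rV[R]_n) : R := (B + B') * I (z + x).
have iI : (lebesgue_rV n).-integrable setT (EFin \o I) := integrable_norm_le n M10.
have iH : (lebesgue_rV n).-integrable setT (EFin \o H).
  exact: (integrableZl measurableT (B + B') (integrable_rV_shift x iI)).
have ibp (r : R) : 0 < r ->
  \int[lebesgue_rV n]_z (if r <= enorm z then fgrad_kernel s u x i j (x + z) else 0)
  = b^-1 * \int[lebesgue_rV n]_z (truncated_riesz b r z * dw (x + z)).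
  move=> r0; under eq_Rintegral do rewrite kE mulrBl.
  have dwx (y : 'rV[R]_n) : is_derive y (delta_mx ord0 j) (fun z => w (x + z)) (dw (x + y)).
    exact: is_derive_translate.
  have [||||||i1 i2 E] := @integral_truncated_riesz_by_parts R n b r j
      (fun z => w (x + z)) (fun z => dw (x + z)) H _ r0.
  - by rewrite b0 ltW.
  - exact: madd.
  - exact: madd.
  - move=> y; rewrite /H /I indicE addrC; case: (leP `|y + x| (M + 1)) => h.
      by rewrite mem_set//= mulr1 (le_trans (wB _))// lerDl.
    by rewrite wM ?normr0 ?mulr_ge0 ?addr_ge0//; lra.
  - move=> y t t1.
    have e1 := @norm_delta_le1 R n j.
    have [_ hB hM] := bounded_support_shift hdw (ex_intro _ B hw) dwP e1 t1.
    rewrite addrA /H /I indicE; case: (leP `|y + x| (M + 1)) => h.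
      rewrite mem_set//= mulr1; apply: le_trans (hB _) _.
      by rewrite ler_wpM2r// lerDr.
    have -> : w (x + y + t *: delta_mx ord0 j) - w (x + y) = 0.
      by apply: hM; rewrite (addrC x).
    by rewrite normr0 !mulr_ge0// addr_ge0.
  - apply: (@le_integrable_R _ _ _ _ setT _ H) => //.
      apply: measurable_funM; last exact: measurable_weight.
      by move/integrableP : iH => [/measurable_EFinP].
    move=> z _; have H0 : 0 <= H z by rewrite /H mulr_ge0 ?addr_ge0.
    rewrite normrM (ger0_norm H0) -[leRHS]mulr1 ler_wpM2l//.
    by rewrite ger0_norm ?weight_ge0// weight_le1// ltW.
  rewrite RintegralB//; last first.
    apply: (@truncated_riesz_grad_integrable R n b r j (cst (w x)) `|w x|) => //.
    exact: ltW.
  have iG := @truncated_riesz_grad_integrable1 R n b r j nb (ltW b0) r0.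
  (* The subtracted value [w x] disappears because the truncated kernel is odd. *)
  rewrite RintegralZl// integral_truncated_riesz_grad ?(ltW b0)// mulr0 subr0 E.
  by congr (_ * _); apply: eq_Rintegral => z _; rewrite mulrC.
apply: has_pv_cst.
- have -> : fgrad_kernel s u x i j = fun y => (w y - w x) * riesz_grad b j (y + - x).
    by apply/funext => y; rewrite fgrad_kernelE.
  apply: measurable_funM; first exact: measurable_funB.
  by apply: measurable_rV_add; exact: measurable_riesz_grad.
- move=> r r0; under eq_fun do rewrite kE.
  apply: (@truncated_riesz_grad_integrable R n b r j _ (B + B)) => //.
  + exact: ltW.
  + by apply: measurable_funB => //; exact: madd.
  + by move=> z; rewrite (le_trans (ler_normB _ _))// lerD.
- have := @truncated_riesz_potential_cvg R n b B' M dw x bb M0 hdw.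
  move=> /(cvgM (cvg_cst b^-1)); apply: cvg_trans; apply: near_eq_cvg.
  near=> r; rewrite ibp//.
Unshelve. all: by end_near. Qed.

(** * Cofactors *)

(* Composing [s] with the transposition of [a] and [r] changes its sign and, by
   symmetry of [d], nothing else. *)
Lemma cofactor_divergence (R : numDomainType) k (a : 'I_k)
    (g : 'I_k -> 'I_k -> R) (d : 'I_k -> 'I_k -> 'I_k -> R) :
  (forall l r m, d l r m = d m r l) ->
  \sum_(s : 'S_k) (-1) ^+ s * (\sum_(r | a != r) d (s a) r (s r) *
     \prod_(r' | (a != r') && (r' != r)) g r' (s r')) = 0.
Proof.
move=> dC; under eq_bigr do rewrite mulr_sumr.
rewrite exchange_big/= big1// => r ar.
set S := LHS; suff SN : S = - S by apply/eqP; rewrite -eqNr eq_sym; apply/eqP.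
rewrite {1}/S (reindex_inj (mulgI (tperm a r)))/= /S -sumrN.
apply: eq_bigr => s _; rewrite odd_permM odd_tperm ar signr_addb expr1 mulN1r mulNr.
congr (- (_ * _)); rewrite !permM tpermL tpermR dC; congr (_ * _).
apply: eq_bigr => r' /andP[ar' rr']; rewrite permM tpermD// eq_sym //.
Qed.

(** [uniq] ensures that the condition [i' != i] removes exactly one factor. *)
Lemma is_derive_prod_seq (R : realType) (V : normedModType R) (I : eqType) (s : seq I)
    (f df : I -> V -> R) (y v : V) : uniq s ->
  (forall i, is_derive y v (f i) (df i y)) ->
  is_derive y v (fun z => \prod_(i <- s) f i z)
    (\sum_(i <- s) df i y * \prod_(i' <- s | i' != i) f i' y).
Proof.
move=> us dfP; elim: s us => [_|i0 s IH /= /andP[i0s us]].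
  rewrite big_nil; have -> : (fun z : V => \prod_(i <- [::]) f i z) = cst 1.
    by apply/funext => z; rewrite big_nil.
  exact: is_derive_cst.
have -> : (fun z : V => \prod_(i <- i0 :: s) f i z) =
    f i0 * (fun z => \prod_(i <- s) f i z).
  by apply/funext => z; rewrite big_cons.
have ds := IH us; apply: is_derive_eq.
rewrite big_cons big_cons eqxx/= [in RHS]addrC.
have neq i : i \in s -> i0 != i by apply: contraTneq => <-.
congr (_ + _).
  rewrite /GRing.scale/= mulr_sumr [LHS]big_seq [RHS]big_seq; apply: eq_bigr => i si.
  by rewrite big_cons neq// mulrCA.
rewrite /GRing.scale/= mulrC; congr (_ * _).
rewrite [LHS]big_seq [RHS]big_seq_cond; apply: eq_bigl => i.
by case: (boolP (i \in s)) => //= si; rewrite eq_sym neq.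
Qed.

Lemma is_derive_prod (R : realType) (V : normedModType R) (I : finType) (P : pred I)
    (f df : I -> V -> R) (y v : V) :
  (forall i, is_derive y v (f i) (df i y)) ->
  is_derive y v (fun z => \prod_(i | P i) f i z)
    (\sum_(i | P i) df i y * \prod_(i' | P i' && (i' != i)) f i' y).
Proof.
move=> dfP; pose s := [seq i <- index_enum I | P i].
have us : uniq s by rewrite filter_uniq// index_enum_uniq.
have := is_derive_prod_seq us dfP.
have -> : (fun z : V => \prod_(i <- s) f i z) = (fun z => \prod_(i | P i) f i z).
  by apply/funext => z; rewrite big_filter.
by rewrite big_filter; under eq_bigr do rewrite big_filter_cond.
Qed.

(** * Functions whose values and increments decay *)

(** The form in which integration by parts wants its majorants. Increments replace derivatives so
    that products can be estimated directly. *)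
Definition tame (R : realType) n (a : R) (f : 'rV[R]_n -> R) : Prop :=
  measurable_fun setT f /\
  exists2 C : R, 0 <= C & (forall y, `|f y| <= C * weight a y) /\
    forall (l : 'I_n) (y : 'rV[R]_n) (t : R), `|t| <= 1 ->
      `|f (y + t *: delta_mx ord0 l) - f y| <= C * weight a y * `|t|.

Lemma weight0E (R : realType) n (y : 'rV[R]_n) : weight 0 y = 1.
Proof. by rewrite /weight oppr0 powRr0. Qed.

Lemma tame_weaken (R : realType) n (a : R) (f : 'rV[R]_n -> R) :
  0 <= a -> tame a f -> tame 0 f.
Proof.
move=> a0 [mf [C C0 [fC dC]]]; split => //; exists C => //.
split=> [y|l y t t1]; rewrite weight0E mulr1.
  by rewrite (le_trans (fC y))// ler_piMr// weight_le1.
by rewrite (le_trans (dC l y t t1))// ler_wpM2r// ler_piMr// weight_le1.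
Qed.

Lemma tame_cst (R : realType) n (c : R) : tame 0 (fun _ : 'rV[R]_n => c).
Proof.
split; first exact: measurable_cst.
exists `|c| => //; split=> [y|l y t t1]; rewrite weight0E mulr1//.
by rewrite subrr normr0 mulr_ge0.
Qed.

(** Splitting the increment of the product leaves one decaying factor in each piece, the other
    factor being bounded. *)
Lemma tame_mul (R : realType) n (a : R) (f g : 'rV[R]_n -> R) :
  tame a f -> tame 0 g -> tame a (fun y => f y * g y).
Proof.
move=> [mf [C C0 [fC dC]]] [mg [D D0 [gD dD]]]; split.
  exact: measurable_funM.
have {}gD y : `|g y| <= D by have := gD y; rewrite weight0E mulr1.
exists (3 * (C * D)); first by rewrite !mulr_ge0.
split=> [y|l y t t1].
  apply: (@le_trans _ _ (C * weight a y * D)); first by rewrite normrM ler_pM.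
  have := mulr_ge0 (mulr_ge0 C0 (weight_ge0 a y)) D0; lra.
have w0 := weight_ge0 a y; have CD := mulr_ge0 (mulr_ge0 C0 w0) D0.
set e := delta_mx ord0 l.
have -> : f (y + t *: e) * g (y + t *: e) - f y * g y =
  (f (y + t *: e) - f y) * g (y + t *: e) + f y * (g (y + t *: e) - g y) by ring.
have h1 : `|(f (y + t *: e) - f y) * g (y + t *: e)| <= C * weight a y * `|t| * D.
  by rewrite normrM ler_pM// dC.
have h2 : `|f y * (g (y + t *: e) - g y)| <= C * weight a y * (D * `|t|).
  by rewrite normrM ler_pM//; have := dD l y t t1; rewrite weight0E mulr1.
apply: le_trans (ler_normD _ _) _; apply: le_trans (lerD h1 h2) _.
have := mulr_ge0 CD (normr_ge0 t); lra.
Qed.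

Lemma tame_prod0 (R : realType) n (I : Type) (s : seq I) (P : pred I)
    (f : I -> 'rV[R]_n -> R) :
  (forall i, tame 0 (f i)) -> tame 0 (fun y => \prod_(i <- s | P i) f i y).
Proof.
move=> tf; elim: s => [|i s IH].
  by under eq_fun do rewrite big_nil; exact: tame_cst.
under eq_fun do rewrite big_cons; case: (P i) => //.
exact: tame_mul.
Qed.

(** The witness [i0] supplies the decay: an empty product is the constant 1. *)
Lemma tame_prod (R : realType) n (a : R) (I : finType) (P : pred I) (i0 : I)
    (f : I -> 'rV[R]_n -> R) : 0 <= a -> P i0 ->
  (forall i, tame a (f i)) -> tame a (fun y => \prod_(i | P i) f i y).
Proof.
move=> a0 Pi0 tf; under eq_fun do rewrite (bigD1 i0)//=.
apply: tame_mul => //; apply: tame_prod0 => i; exact: tame_weaken (tf i).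
Qed.

Lemma tame_scale (R : realType) n (a c : R) (f : 'rV[R]_n -> R) :
  tame a f -> tame a (fun y => c * f y).
Proof.
move=> tf; have -> : (fun y => c * f y) = fun y => f y * c by apply/funext => y; rewrite mulrC.
exact: tame_mul tf (tame_cst n c).
Qed.

Lemma tame_translate (R : realType) n (a : R) (x : 'rV[R]_n) (f : 'rV[R]_n -> R) :
  0 <= a -> tame a f -> tame a (fun y => f (x + y)).
Proof.
move=> a0 [mf [C C0 [fC dC]]]; split.
  by under eq_fun do rewrite addrC; exact: measurable_rV_add.
have p0 : 0 <= (1 + `|x|) `^ a by exact: powR_ge0.
have wx y : weight a (x + y) <= (1 + `|x|) `^ a * weight a y.
  by rewrite addrC; exact: weight_shift.
exists (C * (1 + `|x|) `^ a); first by rewrite mulr_ge0.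
split=> [y|l y t t1].
  by rewrite (le_trans (fC _))// -mulrA ler_wpM2l.
rewrite addrA (le_trans (dC _ _ _ t1))// ler_wpM2r// -mulrA ler_wpM2l//.
Qed.

Lemma Rintegral_sum d (T : measurableType d) (R : realType)
    (mu : {measure set T -> \bar R}) (I : Type) (s : seq I) (f : I -> T -> R) :
  (forall i, mu.-integrable setT (EFin \o f i)) ->
  mu.-integrable setT (EFin \o (fun x => \sum_(i <- s) f i x)) /\
  \int[mu]_x (\sum_(i <- s) f i x) = \sum_(i <- s) \int[mu]_x f i x.
Proof.
move=> fi; elim: s => [|i s [IH1 IH2]].
  have -> : (fun x => \sum_(i <- [::]) f i x) = cst 0.
    by apply/funext => x; rewrite big_nil.
  split; first exact: integrable0.
  by rewrite big_nil /Rintegral integral0.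
have -> : (fun x => \sum_(i <- i :: s) f i x) =
    fun x => f i x + \sum_(i <- s) f i x.
  by apply/funext => x; rewrite big_cons.
split; first exact: (integrableD measurableT (fi i) IH1).
by rewrite RintegralD// big_cons IH2.
Qed.

(** * The fractional gradient as a gradient *)

Section frac_gradient.
Context {R : realType} {n : nat}.
Variables (s : R) (u : 'rV[R]_n -> 'rV[R]_n).
Hypotheses (n0 : (0 < n)%N) (s01 : 0 < s < 1).
Hypotheses (su : smooth u) (cu : compactly_supported u).

Let b : R := n%:R + s - 1.

Let bn : 0 < b < n%:R. Proof. exact: riesz_order_bounds. Qed.

Definition fgrad_entry (i j : 'I_n) (x : 'rV[R]_n) : R := fgrad s u x i j.

(** The potential of a second derivative of [u], so symmetry in [l] and [j] is inherited from
    [u]. *)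
Definition fgrad_entry_derive (l i j : 'I_n) (x : 'rV[R]_n) : R :=
  frac_const n s * b^-1 *
  riesz_potential b (fun z => iter_partial [:: l; j] u z ord0 i) x.

Lemma fgrad_entryE i j : fgrad_entry i j = fun x => frac_const n s * b^-1 *
  riesz_potential b (fun z => iter_partial [:: j] u z ord0 i) x.
Proof.
apply/funext => x; rewrite /fgrad_entry mxE.
by have [_ ->] := fgrad_pv x i j n0 s01 su cu; rewrite mulrA.
Qed.

Lemma fgrad_entry_deriveC l i j x :
  fgrad_entry_derive l i j x = fgrad_entry_derive j i l x.
Proof.
have E : (fun z => iter_partial [:: l; j] u z ord0 i) =
    (fun z => iter_partial [:: j; l] u z ord0 i).
  by apply/funext => z; exact: (@smooth_partialC R n n u i l j z su).
exact: (congr1 (fun h => frac_const n s * b^-1 * riesz_potential b h x) E).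
Qed.

Lemma measurable_fgrad_entry_derive l i j :
  measurable_fun setT (fgrad_entry_derive l i j).
Proof.
apply: measurable_funM => //; apply: measurable_riesz_potential.
by apply: continuous_measurable_rV; exact: smooth_coord_continuous.
Qed.

Lemma is_derive_fgrad_entry l i j (x : 'rV[R]_n) :
  is_derive x (delta_mx ord0 l) (fgrad_entry i j) (fgrad_entry_derive l i j x).
Proof.
have [M M0 bs] := smooth_bounded_support su cu.
have [B hw] := bs [:: j] i; have [B' hdw] := bs [:: l; j] i.
rewrite fgrad_entryE.
have d := is_derive_riesz_potential x bn M0 hw hdw
  (fun y => @smooth_coord_is_derive _ _ _ _ [:: j] i l y su).
exact: is_deriveZ.
Qed.

Lemma tame_fgrad_entry i j : tame b (fgrad_entry i j).
Proof.
have [M M0 bs] := smooth_bounded_support su cu.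
rewrite fgrad_entryE; apply: tame_scale.
have [B hw] := bs [:: j] i; have [mw _ _] := hw; split.
  exact: measurable_riesz_potential.
have [C C0 TB] := riesz_potential_bound bn M0.
have B0 : 0 <= B by have [_ h _] := hw; exact: le_trans (h 0).
have shift l : exists2 C : R, 0 <= C & forall (x : 'rV[R]_n) (t : R), `|t| <= 1 ->
    `|riesz_potential b (fun z => iter_partial [:: j] u z ord0 i)
        (x + t *: delta_mx ord0 l) -
      riesz_potential b (fun z => iter_partial [:: j] u z ord0 i) x|
      <= C * weight b x * `|t|.
  have [B' hdw] := bs [:: l; j] i.
  exact: (riesz_potential_shift_bound bn M0 hw hdw
    (fun y => @smooth_coord_is_derive _ _ _ _ [:: j] i l y su)).
(* The constant for increments depends on the direction; the sum over the finitely many directions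
   serves all of them. *)
pose D l := sval (cid2 (shift l)).
have D0 l : 0 <= D l by rewrite /D; case: cid2.
have DP l (x : 'rV[R]_n) (t : R) : `|t| <= 1 ->
    `|riesz_potential b (fun z => iter_partial [:: j] u z ord0 i)
        (x + t *: delta_mx ord0 l) -
      riesz_potential b (fun z => iter_partial [:: j] u z ord0 i) x|
      <= D l * weight b x * `|t|.
  by rewrite /D; case: cid2 => C' /= _; exact.
have S0 : 0 <= \sum_l D l by apply: sumr_ge0.
exists (B * C + \sum_l D l); first by rewrite addr_ge0 ?mulr_ge0.
split=> [y|l y t t1].
  have [_ h] := TB B _ y hw; apply: le_trans h _.
  by rewrite ler_wpM2r ?weight_ge0// lerDl.
apply: le_trans (DP l y t t1) _; rewrite !ler_wpM2r ?weight_ge0//.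
rewrite (bigD1 l)//= addrCA lerDl addr_ge0 ?mulr_ge0//.
by apply: sumr_ge0.
Qed.

Variables (k : nat) (p q : 'I_k -> 'I_n) (a : 'I_k).

(* The term of the permutation [sg] in the Leibniz expansion of the cofactors of
   row [a], without its sign; it belongs to the cofactor in column [sg a]. *)
Definition minor_term (sg : 'S_k) (x : 'rV[R]_n) : R :=
  \prod_(r | a != r) fgrad_entry (p r) (q (sg r)) x.

Definition minor_term_derive (sg : 'S_k) (l : 'I_n) (x : 'rV[R]_n) : R :=
  \sum_(r | a != r) fgrad_entry_derive l (p r) (q (sg r)) x *
    \prod_(r' | (a != r') && (r' != r)) fgrad_entry (p r') (q (sg r')) x.

Lemma is_derive_minor_term sg l (x : 'rV[R]_n) :
  is_derive x (delta_mx ord0 l) (minor_term sg) (minor_term_derive sg l x).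
Proof.
apply: (@is_derive_prod _ _ _ (fun r => a != r)
  (fun r => fgrad_entry (p r) (q (sg r)))
  (fun r => fgrad_entry_derive l (p r) (q (sg r)))).
by move=> r; exact: is_derive_fgrad_entry.
Qed.

(** Order 0 also covers [k = 1], where the product is empty and does not decay. *)
Lemma tame0_minor_term sg : tame 0 (minor_term sg).
Proof.
apply: tame_prod0 => r; apply: tame_weaken (tame_fgrad_entry _ _).
by case/andP: bn => /ltW.
Qed.

Lemma measurable_minor_term_derive sg l : measurable_fun setT (minor_term_derive sg l).
Proof.
rewrite /minor_term_derive; under eq_fun do rewrite big_mkcond/=.
apply: measurable_sum => r; case: (a != r) => //; apply: measurable_funM.
  exact: measurable_fgrad_entry_derive.
under eq_fun do rewrite big_mkcond/=.
apply: measurable_prod => r' _; case: (_ && _) => //.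
by have [] := tame_fgrad_entry (p r') (q (sg r')).
Qed.
End frac_gradient.

Section divergence.
Context {R : realType} {n : nat}.
Variables (s : R) (u : 'rV[R]_n -> 'rV[R]_n).
Hypotheses (n0 : (0 < n)%N) (s01 : 0 < s < 1).
Hypotheses (su : smooth u) (cu : compactly_supported u).
Variables (k : nat) (p q : 'I_k -> 'I_n) (a : 'I_k).
Hypotheses (kn : (k <= n)%N).

Let b : R := n%:R + s - 1.

Let bn : 0 < b < n%:R. Proof. exact: riesz_order_bounds. Qed.

Let b0 : 0 <= b. Proof. by case/andP: bn => /ltW. Qed.

Let nb : n%:R < b + 1.
Proof. by move: s01 => /andP[h1 h2]; rewrite /b; lra. Qed.

Lemma minor_term_by_parts (sg : 'S_k) (l : 'I_n) (x : 'rV[R]_n) (r : R) : 0 < r ->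
  (lebesgue_rV n).-integrable setT
    (EFin \o (fun z => minor_term_derive s u p q a sg l (x + z) * truncated_riesz b r z)) /\
  \int[lebesgue_rV n]_z
     (minor_term s u p q a sg (x + z) * truncated_riesz_grad b r l z) =
  b^-1 * \int[lebesgue_rV n]_z
     (minor_term_derive s u p q a sg l (x + z) * truncated_riesz b r z).
Proof.
(* If no index differs from [a], that is [k = 1], the term is the constant 1: the left side vanishes
   by oddness and the right side because the derivative is 0. *)
move=> r0; have [r1 ar1|none] := pickP (fun r => a != r); last first.
  have -> : minor_term s u p q a sg = cst 1.
    by apply/funext => z; rewrite /minor_term big_pred0.
  have -> : minor_term_derive s u p q a sg l = cst 0.
    by apply/funext => z; rewrite /minor_term_derive big_pred0.
  under [in X in _ /\ X]eq_Rintegral do rewrite /= mul1r.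
  rewrite integral_truncated_riesz_grad//.
  have -> : (fun z : 'rV[R]_n => cst 0 (x + z) * truncated_riesz b r z) = cst 0.
    by apply/funext => z /=; rewrite mul0r.
  split; first exact: integrable0.
  by rewrite /Rintegral integral0 /= mulr0.
have tP : tame b (fun z => minor_term s u p q a sg (x + z)).
  apply: tame_translate => //; apply: (tame_prod (i0 := r1)) => // r'.
  exact: tame_fgrad_entry.
have [mP [C C0 [PC dPC]]] := tP.
have dP (y : 'rV[R]_n) : is_derive y (delta_mx ord0 l)
    (fun z => minor_term s u p q a sg (x + z))
    (minor_term_derive s u p q a sg l (x + y)).
  by apply: is_derive_translate; exact: is_derive_minor_term.
have k2 : (1 < k)%N.
  case: k a sg r1 ar1 {tP mP PC dPC dP} p q kn => [[]//|[|//]] a' sg' r1' + _ _ _.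
  by rewrite !ord1 eqxx.
have n2 : 2 <= n%:R :> R by rewrite ler_nat (leq_trans k2).
(* For [k >= 2] each term has a factor decaying like the kernel, and the product
   of the two decays is integrable since [2 * b = n + (n - 2 + 2 * s)]. *)
have nbb : n%:R < b + b by move: s01 => /andP[h1 h2]; rewrite /b; lra.
have [|||||i1 i2 E] := @integral_truncated_riesz_by_parts R n b r l
  (fun z => minor_term s u p q a sg (x + z))
  (fun z => minor_term_derive s u p q a sg l (x + z))
  (fun z => C * weight b z) _ r0 mP.
- by have /andP[-> /ltW] := bn.
- under eq_fun do rewrite addrC; apply: measurable_rV_add.
  exact: measurable_minor_term_derive.
- exact: PC.
- exact: dPC.
- have := integrableZl measurableT C (weight_integrable nbb).
  by apply: eq_integrable => // z _; rewrite /= weightD -EFinM mulrA.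
by [].
Qed.

(** The permutation [sg] belongs to column [sg a], hence to component [q (sg a)] of the extended
    row; this is the direction in which its term is integrated by parts. *)
Lemma minor_terms_cancel (x : 'rV[R]_n) (r : R) : 0 < r ->
  \sum_(sg : 'S_k) (-1) ^+ sg * \int[lebesgue_rV n]_z
    (minor_term s u p q a sg (x + z) * truncated_riesz_grad b r (q (sg a)) z) = 0.
Proof.
move=> r0.
pose f (sg : 'S_k) z := minor_term_derive s u p q a sg (q (sg a)) (x + z) *
  truncated_riesz b r z.
have fi sg : (lebesgue_rV n).-integrable setT (EFin \o f sg).
  by have [] := minor_term_by_parts sg (q (sg a)) x r0.
have gi (sg : 'S_k) : (lebesgue_rV n).-integrable setT
    (EFin \o (fun z => (-1) ^+ sg * f sg z)).
  exact: (integrableZl measurableT ((-1) ^+ sg) (fi sg)).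
transitivity (b^-1 * \sum_(sg : 'S_k) \int[lebesgue_rV n]_z ((-1) ^+ sg * f sg z)).
  rewrite mulr_sumr; apply: eq_bigr => sg _.
  rewrite (RintegralZl ((-1) ^+ sg) measurableT (fi sg)) mulrCA; congr (_ * _).
  by have [] := minor_term_by_parts sg (q (sg a)) x r0.
have [_ <-] := Rintegral_sum (index_enum {perm 'I_k}) gi.
rewrite (_ : (fun z => _) = cst 0); first by rewrite /Rintegral integral0 mulr0.
apply/funext => z /=; rewrite /f; under eq_bigr do rewrite mulrA.
rewrite -mulr_suml [X in X * _](_ : _ = 0) ?mul0r//.
(* Here [d l r c] is the derivative of the entry [(p r, q c)] in direction [q l], symmetric in [l]
   and [c]. *)
apply: (@cofactor_divergence _ _ a
  (fun r c => fgrad_entry s u (p r) (q c) (x + z))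
  (fun l r c => fgrad_entry_derive s u (q l) (p r) (q c) (x + z))).
by move=> l r' m; exact: fgrad_entry_deriveC.
Qed.

End divergence.

(** * The fractional divergence *)

Lemma strictly_increasing_inj k n (p : 'I_k -> 'I_n) :
  (forall a b : 'I_k, (a < b)%N -> (p a < p b)%N) -> injective p.
Proof.
move=> hp a b pab; apply/val_inj; case: (ltngtP a b) => // /hp; by rewrite pab ltnn.
Qed.

Lemma sum_zero_extended_row (R : pzRingType) k n (q : 'I_k -> 'I_n) (f : 'I_k -> R)
    (h : 'I_n -> R) : injective q ->
  \sum_j (if [pick b | q b == j] is Some b then f b else 0) * h j =
  \sum_b f b * h (q b).
Proof.
move=> qI; transitivity (\sum_j \sum_(b | q b == j) f b * h (q b)).
  apply: eq_bigr => j _; case: pickP => [b /eqP <-|none].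
    by rewrite (big_pred1 b)// => c /=; rewrite (inj_eq qI).
  by rewrite big_pred0// mul0r.
by rewrite [RHS](partition_big q xpredT).
Qed.

Lemma zero_extension_row (R : comPzRingType) k n (p q : 'I_k -> 'I_n) (F : 'M[R]_k) a j :
  injective p -> zero_extension p q F (p a) j =
  if [pick b | q b == j] is Some b then F a b else 0.
Proof.
move=> pI; rewrite mxE; case: pickP => [c /eqP/pI -> //|/(_ a)].
by rewrite eqxx.
Qed.

(** Unlike in [fgrad_kernelE] only one factor is odd under exchanging [x] and [y], whence the minus
    sign. *)
Lemma fdiv_kernelE (R : realType) n (s : R) (phi : 'rV[R]_n -> 'rV[R]_n) x y :
  fdiv_kernel s phi x y = - (\sum_j phi x ord0 j * riesz_grad (n%:R + s - 1) j (y + - x) +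
    \sum_j phi y ord0 j * riesz_grad (n%:R + s - 1) j (y + - x)).
Proof.
rewrite -big_split/= -sumrN; apply: eq_bigr => j _.
rewrite -(opprB x y) riesz_gradN /riesz_grad subrK mxE; ring.
Qed.

Lemma fdiv_kernel_eq0 (R : realType) n (s : R) (phi : 'rV[R]_n -> 'rV[R]_n) x :
  (forall y, phi y = 0) -> fdiv_kernel s phi x = cst 0.
Proof.
move=> phi0; apply/funext => y; rewrite /fdiv_kernel big1// => j _.
by rewrite !phi0 addr0 mxE !mul0r.
Qed.

(** The hypothesis says that [phi y] is the sum of the [c i * P i y] times the basis vector [l i],
    tested against an arbitrary [h]; several indices may share a component, as permutations do. *)
Lemma fdiv_kernel_sum (R : realType) n (s : R) (phi : 'rV[R]_n -> 'rV[R]_n)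
    (I : finType) (c : I -> R) (P : I -> 'rV[R]_n -> R) (l : I -> 'I_n) x y :
  (forall y h, \sum_j phi y ord0 j * h j = \sum_i c i * (P i y * h (l i))) ->
  fdiv_kernel s phi x y =
  - \sum_i c i * ((P i x + P i y) * riesz_grad (n%:R + s - 1) (l i) (y + - x)).
Proof.
move=> phiE; rewrite fdiv_kernelE !phiE -big_split/=; congr (- _).
by apply: eq_bigr => i _; rewrite -mulrDr -mulrDl.
Qed.

(** The Leibniz expansion of the cofactors of row [a], with the permutations grouped by the column
    [sg a]. *)
Lemma sum_cofactor_row (R : realType) n (s : R) (u : 'rV[R]_n -> 'rV[R]_n) k
    (p q : 'I_k -> 'I_n) (a : 'I_k) (h : 'I_n -> R) y :
  injective p -> injective q ->
  \sum_j row (p a) (zero_extension p q (cof (submatrix p q (fgrad s u y)))) ord0 j * h j =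
  \sum_(sg : 'S_k) (-1) ^+ sg * (minor_term s u p q a sg y * h (q (sg a))).
Proof.
move=> pI qI.
under eq_bigr do rewrite mxE zero_extension_row//.
rewrite (sum_zero_extended_row _ _ qI) (partition_big (fun sg : 'S_k => sg a) xpredT)//=.
apply: eq_bigr => c _; rewrite mxE expand_cofactor mulr_suml.
apply: eq_bigr => sg /eqP <-; rewrite -mulrA; congr (_ * (_ * _)).
by apply: eq_bigr => r _; rewrite mxE.
Qed.

(** Each [P i] is bounded and the kernel is integrable off the ball, so at fixed [r] the integral
    splits into its finitely many terms and each term into its parts at [x] and at [y]. Oddness
    removes the first, [cancel] the second. *)
Lemma fdiv_pv_eq0 (R : realType) n (s : R) (phi : 'rV[R]_n -> 'rV[R]_n)
    (I : finType) (c : I -> R) (P : I -> 'rV[R]_n -> R) (l : I -> 'I_n) x :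
  let b := n%:R + s - 1 in 0 <= b -> n%:R < b + 1 ->
  (forall i, tame 0 (P i)) ->
  (forall y h, \sum_j phi y ord0 j * h j = \sum_i c i * (P i y * h (l i))) ->
  (forall r, 0 < r -> \sum_i c i * \int[lebesgue_rV n]_z
     (P i (x + z) * truncated_riesz_grad b r (l i) z) = 0) ->
  has_pv x (fdiv_kernel s phi x) /\ pv x (fdiv_kernel s phi x) = 0.
Proof.
move=> b b0 nb tP phiE cancel.
pose T (G : I -> 'rV[R]_n -> R) y z := \sum_i c i * ((P i x + P i y) * G i z).
have kT (r : R) z :
    (if r <= enorm z then fdiv_kernel s phi x (x + z) else 0) =
    - 1 * T (fun i => truncated_riesz_grad b r (l i)) (x + z) z.
  rewrite /T /truncated_riesz_grad; case: ifP => _.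
    rewrite (fdiv_kernel_sum s x (x + z) phiE) mulN1r; congr (- _).
    by apply: eq_bigr => i _; rewrite [x + z + _]addrAC subrr add0r.
  by rewrite big1 ?mulr0// => i _; rewrite !mulr0.
have mPx i : measurable_fun setT (fun z => P i (x + z)).
  by have [mP _] := tP i; under eq_fun do rewrite addrC; exact: measurable_rV_add.
have bP i : exists C, forall y, `|P i y| <= C.
  have [_ [C C0 [PC _]]] := tP i; exists C => y.
  by have := PC y; rewrite weight0E mulr1.
have i1 r j (d : R) : 0 < r -> (lebesgue_rV n).-integrable setT
    (EFin \o (fun z => d * truncated_riesz_grad b r j z)).
  move=> r0; exact: (@truncated_riesz_grad_integrable R n b r j (cst d) `|d|).
have i2 i r j : 0 < r -> (lebesgue_rV n).-integrable setT
    (EFin \o (fun z => P i (x + z) * truncated_riesz_grad b r j z)).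
  move=> r0; have [C PC] := bP i.
  exact: (@truncated_riesz_grad_integrable R n b r j (fun z => P i (x + z)) C).
have i12 i r j : 0 < r -> (lebesgue_rV n).-integrable setT
    (EFin \o (fun z => (P i x + P i (x + z)) * truncated_riesz_grad b r j z)).
  move=> r0; have := integrableD measurableT (i1 r j (P i x) r0) (i2 i r j r0).
  by apply: eq_integrable => // z _ /=; rewrite mulrDl.
have i12c i r j : 0 < r -> (lebesgue_rV n).-integrable setT
    (EFin \o (fun z => c i *
      ((P i x + P i (x + z)) * truncated_riesz_grad b r j z))).
  by move=> r0; exact: (integrableZl measurableT (c i) (i12 i r j r0)).
have iT r : 0 < r -> (lebesgue_rV n).-integrable setT
    (EFin \o (fun z => T (fun i => truncated_riesz_grad b r (l i)) (x + z) z)) /\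
    \int[lebesgue_rV n]_z T (fun i => truncated_riesz_grad b r (l i)) (x + z) z = 0.
  move=> r0; have [iS ->] := Rintegral_sum (index_enum I) (fun i => i12c i r (l i) r0).
  split=> //; rewrite -[RHS](cancel r r0).
  apply: eq_bigr => i _.
  rewrite (RintegralZl (c i) measurableT (i12 i r (l i) r0)).
  congr (_ * _); have i1' := i1 r (l i) (P i x) r0.
  under eq_Rintegral do rewrite mulrDl.
  rewrite (RintegralD measurableT i1' (i2 i r (l i) r0)).
  have iG := @truncated_riesz_grad_integrable1 R n b r (l i) nb b0 r0.
  rewrite (RintegralZl (P i x) measurableT iG).
  by rewrite integral_truncated_riesz_grad// mulr0 add0r.
apply: has_pv_cst.
- have -> : fdiv_kernel s phi x = fun y =>
      - 1 * T (fun i => riesz_grad b (l i)) y (y + - x).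
    by apply/funext => y; rewrite (fdiv_kernel_sum s x y phiE) mulN1r.
  apply: measurable_funM => //; apply: measurable_sum => i.
  apply: measurable_funM => //; apply: measurable_funM.
    by apply: measurable_funD => //; have [] := tP i.
  by apply: measurable_rV_add; exact: measurable_riesz_grad.
- move=> r r0; under eq_fun do rewrite kT.
  by have [iS _] := iT r r0; exact: (integrableZl measurableT (- 1) iS).
apply: cvg_near_cst; near=> r.
have r0 : 0 < r by [].
have [iS I0] := iT r r0.
under eq_Rintegral do rewrite kT.
by rewrite (RintegralZl (- 1) measurableT iS) I0 mulr0.
Unshelve. all: by end_near. Qed.

(** Existence of all principal values is part of the conclusion, because [pv] takes an unspecified
    value where the limit does not exist. *)
Theorem theorem4p2 (R : realType) (n k : nat) (hk : (1 <= k <= n)%N)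
    (p q : 'I_k -> 'I_n)
    (hp : forall a b : 'I_k, (a < b)%N -> (p a < p b)%N)
    (hq : forall a b : 'I_k, (a < b)%N -> (q a < q b)%N)
    (u : 'rV[R]_n -> 'rV[R]_n) (hu : smooth u) (hcu : compactly_supported u)
    (s : R) (hs : 0 < s < 1) :
  (forall x, has_fgrad s u x) /\
  (forall x,
     has_fDiv s (fun y => zero_extension p q (cof (submatrix p q (fgrad s u y)))) x /\
     fDiv s (fun y => zero_extension p q (cof (submatrix p q (fgrad s u y)))) x = 0).
Proof.
have /andP[k1 kn] := hk; have n0 : (0 < n)%N by exact: leq_trans kn.
have pI := strictly_increasing_inj hp; have qI := strictly_increasing_inj hq.
pose A y := zero_extension p q (cof (submatrix p q (fgrad s u y))).
split=> [x i j|x]; first by have [] := fgrad_pv x i j n0 hs hu hcu.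
suff main i : has_pv x (fdiv_kernel s (fun y => row i (A y)) x) /\
    pv x (fdiv_kernel s (fun y => row i (A y)) x) = 0.
  split=> [i|]; first by have [] := main i.
  apply/matrixP => i j; rewrite !mxE /fdiv.
  by have [_ ->] := main i; rewrite mulr0.
pose b : R := n%:R + s - 1.
have b0 : 0 <= b by have /andP[/ltW] := riesz_order_bounds n0 hs.
have nb : n%:R < b + 1 by move: hs => /andP[s0 _]; rewrite /b; lra.
(* Rows outside the range of [p] are identically zero, and so is their kernel; the other rows carry
   the cofactors. *)
have [/existsP[a /eqP <-]|/existsPn ni] := boolP [exists a, p a == i]; last first.
  have row0 y : row i (A y) = 0.
    apply/rowP => j; rewrite mxE /A mxE [RHS]mxE; case: pickP => // a pa.
    by have := ni a; rewrite pa.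
  rewrite (fdiv_kernel_eq0 s x row0).
  have E : (fun r : R => \int[lebesgue_rV n]_z
      (if r <= enorm z then cst 0 (x + z) else 0)) = cst 0.
    apply/funext => r; rewrite /Rintegral integral0_eq// => z _.
    by case: ifP.
  apply: has_pv_cst => [|r r0|]; first exact: measurable_cst.
    by under eq_fun do rewrite if_same; exact: integrable0.
  by rewrite E; exact: cvg_cst.
apply: (@fdiv_pv_eq0 R n s _ {perm 'I_k} (fun sg => (-1) ^+ sg)
  (minor_term s u p q a) (fun sg => q (sg a))) => //.
- by move=> sg; exact: tame0_minor_term.
- by move=> y h; exact: (sum_cofactor_row s u a h y pI qI).
- by move=> r r0; exact: (minor_terms_cancel n0 hs hu hcu p q a kn x r0).
Qed.
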